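(* Let $A$ be a real $m\times n$ matrix of full column rank $n$, let $S$ be a $k\times m$ Gaussian matrix, and let $(x_t)_{t\ge0}$ be the iterates of sketch-and-project with sketching distribution $S$, started at an arbitrary $x_0\in\mathbb{R}^n$. (i) (general spectrum) There is an absolute constant $C>0$ such that for any $1\le k\le n$ and all $t\ge0$, $$\mathbb{E}\,\|x_t-x_*\|^2\le\Big(1-\frac{k\,\sigma_{\min}^2(A)}{C\|A\|_F^2}\Big)^t\|x_0-x_*\|^2.$$ (ii) (polynomial decay) If $A$ has polynomial spectral decay of order $\beta>1$, i.e. $\sigma_i^2(A)\le c\,i^{-\beta}\sigma_1^2(A)$ for all $i$ and some $c>0$, then there is a constant $C=C(\beta,c)$ such that for any $k\le n/2$ and all $t\ge0$, $$\mathbb{E}\,\|x_t-x_*\|^2\le\Big(1-\frac{k^\beta\,\sigma_{\min}^2(A)}{C\|A\|_F^2}\Big)^t\|x_0-x_*\|^2.$$ (iii) (exponential decay) If $A$ has exponential spectral decay of order $\alpha>1$, i.e. $\sigma_i^2(A)\le c\,\alpha^{-i}\sigma_1^2(A)$ for all $i$ and some $c>0$, then there is a constant $C=C(\alpha,c)$ such that for any $k\le n/2$ and all $t\ge0$, $$\mathbb{E}\,\|x_t-x_*\|^2\le\Big(1-\frac{\alpha^k\,\sigma_{\min}^2(A)}{C\|A\|_F^2}\Big)^t\|x_0-x_*\|^2.$$ Here the constants depend on nothing except the indicated parameters (in particular not on $A,m,n,k,t,x_0$).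
   Context: A Gaussian matrix has i.i.d. $N(0,1)$ entries. $\sigma_1(A)\ge\sigma_2(A)\ge\dots$ are the singular values of $A$ and $\sigma_{\min}(A)$ is the smallest, $\sigma_n(A)$. $\|\cdot\|$ is the Euclidean norm, $\|\cdot\|_F$ the Frobenius norm, $(\cdot)^\dagger$ the Moore-Penrose pseudoinverse. Sketch-and-project: given a consistent linear system $Ax=b$ with $A\in\mathbb{R}^{m\times n}$, $m\ge n$, and unique solution $x_*$, the iterates are $x_{t+1}=x_t-(S_tA)^\dagger S_t(Ax_t-b)$, $t=0,1,2,\dots$, where $S_0,S_1,\dots$ are independent copies of the random $k\times m$ sketching matrix $S$, and $k\ge1$. *)

(* Defs.v *)
From HB Require Import structures.
From mathcomp Require Import all_boot all_order all_algebra finmap.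
From mathcomp Require Import all_classical all_reals all_analysis.

Set Implicit Arguments.
Unset Strict Implicit.
Unset Printing Implicit Defensive.

Import Order.TTheory GRing.Theory Num.Theory.

Local Open Scope classical_set_scope.
Local Open Scope ring_scope.

Section LinearAlgebra.
Variable R : realType.

(* The library norm on matrices is the max norm, hence these definitions. *)
Definition norm2 n (x : 'cV[R]_n) : R := Num.sqrt (\sum_i x i 0 ^+ 2).

Definition norm_frob m n (A : 'M[R]_(m, n)) : R :=
  Num.sqrt (\sum_i \sum_j A i j ^+ 2).

(* The squares of the singular values are the eigenvalues of A^T A, counted
   with multiplicity; such an s exists, is unique and has n elements. *)
Definition is_singular_values m n (A : 'M[R]_(m, n)) (s : seq R) : Prop :=
  [/\ sorted >=%R s, all (fun x => 0 <= x) s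
    & char_poly (A^T *m A) = \prod_(x <- s) ('X - (x ^+ 2)%:P)].

Definition singular_values m n (A : 'M[R]_(m, n)) : seq R :=
  xget [::] [set s | is_singular_values A s].

(* Indexed from 1. *)
Definition sigma m n (i : nat) (A : 'M[R]_(m, n)) : R :=
  (singular_values A)`_i.-1.

Definition sigma_min m n (A : 'M[R]_(m, n)) : R := sigma n A.

Definition is_moore_penrose m n (A : 'M[R]_(m, n)) (X : 'M[R]_(n, m)) : Prop :=
  [/\ A *m X *m A = A, X *m A *m X = X,
      (A *m X)^T = A *m X & (X *m A)^T = X *m A].

(* Not pinvmx, which is a generalized inverse but not the Moore-Penrose one. *)
Definition moore_penrose m n (A : 'M[R]_(m, n)) : 'M[R]_(n, m) :=
  xget 0 [set X | is_moore_penrose A X].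

Fixpoint sketch_and_project k m n (A : 'M[R]_(m, n)) (b : 'cV[R]_m)
    (S : nat -> 'M[R]_(k, m)) (x0 : 'cV[R]_n) (t : nat) : 'cV[R]_n :=
  if t is t'.+1 then
    let x := sketch_and_project A b S x0 t' in
    x - moore_penrose (S t' *m A) *m (S t' *m (A *m x - b))
  else x0.

Definition polynomial_decay m n (A : 'M[R]_(m, n)) (beta c : R) : Prop :=
  forall i, (1 <= i <= n)%N ->
    sigma i A ^+ 2 <= c * i%:R `^ (- beta) * sigma 1 A ^+ 2.

Definition exponential_decay m n (A : 'M[R]_(m, n)) (alpha c : R) : Prop :=
  forall i, (1 <= i <= n)%N ->
    sigma i A ^+ 2 <= c * alpha ^- i * sigma 1 A ^+ 2.

End LinearAlgebra.

Section Probability.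
Context (d : measure_display) (T : measurableType d) (R : realType).
Variable P : probability T R.

(* Mutual independence of the set systems F i (in use, sigma-algebras). *)
Definition independent (I : choiceType) (F : I -> set (set T)) : Prop :=
  forall (J : {fset I}) (E : I -> set T), (forall i, i \in J -> F i (E i)) ->
    P (\bigcap_(i in [set` J]) E i) = (\prod_(i <- J) P (E i))%E.

Definition entry_events k m (S : T -> 'M[R]_(k, m)) (ij : 'I_k * 'I_m) :
    set (set T) :=
  preimage_set_system setT (fun w => S w ij.1 ij.2) measurable.

(* The sigma-algebra generated by the random matrix S. *)
Definition matrix_events k m (S : T -> 'M[R]_(k, m)) : set (set T) :=
  <<s \bigcup_ij entry_events S ij >>.

Definition gaussian_matrix k m (S : T -> 'M[R]_(k, m)) : Prop :=
  [/\ forall i j, measurable_fun setT (fun w => S w i j),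
      forall i j (B : set R), measurable B ->
        pushforward P (fun w => S w i j) B = normal_prob 0 1 B
    & independent (entry_events S)].

Definition independent_gaussian_matrices k m
    (S : nat -> T -> 'M[R]_(k, m)) : Prop :=
  (forall t, gaussian_matrix (S t)) /\
  independent (fun t => matrix_events (S t)).

End Probability.

(* Main.v *)
Require Import Defs.
From HB Require Import structures.
From mathcomp Require Import all_boot all_order all_fingroup all_algebra finmap.
From mathcomp.real_closed Require Import complex.
From mathcomp Require Import all_classical all_reals all_analysis.
From mathcomp Require Import measurable_realfun ring lra.

Set Implicit Arguments.
Unset Strict Implicit.
Unset Printing Implicit Defensive.

Import Order.TTheory GRing.Theory Num.Theory.

(* With e_t = x_t - x_star one has e_{t+1} = Q(S_t A) e_t, where Q(B) projects
   orthogonally onto the complement of the row space of B, so by independence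
   it suffices to bound E |Q(G A) v|^2 for a fixed v and a Gaussian G.
   Fix r < k. By rotation invariance, the k rows of G have k - r orthonormal
   combinations that annihilate r prescribed left singular directions of A and
   are again independent Gaussian rows for the matrix A' obtained from A by
   deleting the corresponding singular values. Projecting off one Gaussian row
   of A' does at least as well as a relaxed Kaczmarz step, which by a
   computation with second and fourth moments gains a constant times
   |A' v|^2 / |A'|_F^2. Hence the contraction factor
     1 - c0 (k - r) sigma_min^2 / sum_(i > r) sigma_i^2,
   and r = 0, r = k/2, r = k - 1 give the three regimes. The vectors v that are
   not singular vectors are handled by averaging over reflections. *)

Local Open Scope classical_set_scope.
Local Open Scope ring_scope.

(** * Standard Gaussian matrices *)

Section GaussianLaw.
Variable R : realType.

Notation gauss := (normal_prob 0 1 : set R -> \bar R).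

(** Deleting leading directions shrinks the trace in the denominator, but it also deletes the
    components of v along them, so for a general v the numerator |A' v|^2 could vanish. Hence the
    bound is proved for right singular vectors, where the deleted set may depend on the vector and
    always spares its own direction. Sparing a large singular value may inflate the trace, but only
    when that direction carries a constant share of it. Since the law of a Gaussian matrix is
    unchanged by reflecting one left singular direction, the expected residual is a diagonal
    quadratic form in the singular basis, so a factor valid for every basis vector is valid for
    every v. The constant is c0 = m2^2 / (4 m4), with m2 and m4 the second and fourth moments of
    N(0, 1); one factor 2 is lost to the inflated trace and one to the linearization of a power.
    With r = k/2 the tail is of order k^(1 - beta) against about k/2 remaining rows, whence k^beta;
    with r = k - 1 a single row faces a tail of order alpha^(-k). *)

Definition mx_measurable d (T : measurableType d) k m (X : T -> 'M[R]_(k, m)) :=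
  forall i j, measurable_fun setT (fun w => X w i j).

(* Joint measurability of a function of a matrix, phrased through composition
   so that no sigma-algebra on matrices is needed. *)
Definition borel_fun k m (F : 'M[R]_(k, m) -> \bar R) :=
  forall d (T : measurableType d) (X : T -> 'M[R]_(k, m)),
    mx_measurable X -> measurable_fun [set: T] (fun w => F (X w)).

Definition box k m (B : 'M[set R]_(k, m)) : set 'M[R]_(k, m) :=
  [set x | forall i j, B i j (x i j)].

(** Independence of the entries and their marginal laws in one formula, tested on boxes, which form
    a pi-system. *)
Definition std_gaussian d (T : measurableType d) (P : set T -> \bar R) k m
    (X : T -> 'M[R]_(k, m)) : Prop :=
  mx_measurable X /\
  forall B : 'M[set R]_(k, m), (forall i j, measurable (B i j)) ->
    P (X @^-1` box B) = (\prod_i \prod_j gauss (B i j))%E.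

Definition boxes k m : set (set 'M[R]_(k, m)) :=
  [set box B | B in [set B : 'M[set R]_(k, m) | forall i j, measurable (B i j)]].

Definition pointed_matrix k m : pointedType :=
  HB.pack 'M[R]_(k, m) (isPointed.Build 'M[R]_(k, m) 0).

Local Notation V k m := (g_sigma_algebraType (@boxes k m : set (set (pointed_matrix k m)))).

Lemma boxesT k m : @boxes k m setT.
Proof.
exists (const_mx setT); first by move=> i j; rewrite mxE.
by apply/seteqP; split => // x _ i j; rewrite mxE.
Qed.

Lemma boxes_setI k m : setI_closed (@boxes k m).
Proof.
move=> _ _ [B mB <-] [C mC <-].
exists (\matrix_(i, j) (B i j `&` C i j)).
  by move=> i j; rewrite mxE; exact: measurableI.
apply/seteqP; split => x /=.
  by move=> H; split=> i j; have := H i j; rewrite mxE => -[].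
by move=> [H1 H2] i j; rewrite mxE; split; [exact: H1|exact: H2].
Qed.

Lemma measurable_box d (T : measurableType d) k m (X : T -> 'M[R]_(k, m))
    (B : 'M[set R]_(k, m)) :
  mx_measurable X -> (forall i j, measurable (B i j)) ->
  measurable (X @^-1` box B).
Proof.
move=> mX mB.
rewrite (_ : _ @^-1` _ = \bigcap_(i in [set: 'I_k]) \bigcap_(j in [set: 'I_m])
   ((fun w => X w i j) @^-1` B i j)).
  apply: fin_bigcap_measurable => // i _.
  apply: fin_bigcap_measurable => // j _.
  by rewrite -[_ @^-1` _]setTI; apply: mX.
apply/seteqP; split=> w /=; first by move=> H i _ j _; exact: H.
by move=> H i j; exact: H.
Qed.

Lemma mx_measurable_V d (T : measurableType d) k m (X : T -> 'M[R]_(k, m)) :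
  mx_measurable X -> measurable_fun setT (X : T -> V k m).
Proof.
move=> mX; apply: (@measurability _ _ T (V k m) setT X (@boxes k m)) => //.
move=> _ [_ [B mB <-] <-]; rewrite setTI; exact: measurable_box.
Qed.

(** A cylinder over one entry is a box with [setT] elsewhere. Feeding this identity map to
    [borel_fun] makes F measurable for the box sigma-algebra. *)
Lemma mx_measurable_id k m : mx_measurable (id : V k m -> 'M[R]_(k, m)).
Proof.
move=> i j _ B mB; rewrite setTI; apply: sub_sigma_algebra.
exists (\matrix_(i', j') (if (i' == i) && (j' == j) then B else setT)).
  by move=> i' j'; rewrite mxE; case: ifP.
apply/seteqP; split=> x /=.
  by move=> /(_ i j); rewrite mxE !eqxx.
by move=> Bx i' j'; rewrite mxE; case: ifP => // /andP[/eqP-> /eqP->].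
Qed.

(** The two image measures agree on boxes, a pi-system containing the whole space, hence on the
    sigma-algebra that the boxes generate. *)
Lemma std_gaussian_law d (T : measurableType d) (P : probability T R)
   d' (T' : measurableType d') (P' : probability T' R) k m
   (X : T -> 'M[R]_(k, m)) (X' : T' -> 'M[R]_(k, m)) (F : 'M[R]_(k, m) -> \bar R) :
  std_gaussian P X -> std_gaussian P' X' -> borel_fun F -> (forall x, 0 <= F x)%E ->
  (\int[P]_w F (X w) = \int[P']_w F (X' w))%E.
Proof.
move=> [mX PX] [mX' PX'] mF F0.
have mX_ := mx_measurable_V mX; have mX'_ := mx_measurable_V mX'.
have mFV : measurable_fun setT (F : V k m -> \bar R).
  exact: mF (@mx_measurable_id k m).
transitivity (\int[pushforward P (X : T -> V k m)]_(y in setT) F y)%E.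
  by rewrite (ge0_integral_pushforward mX_).
transitivity (\int[pushforward P' (X' : T' -> V k m)]_(y in setT) F y)%E; last first.
  by rewrite (ge0_integral_pushforward mX'_).
apply: eq_measure_integral => A mA _.
apply/esym; move: A mA.
apply: (@measure_unique _ R (V k m) (@boxes k m) (fun=> setT) erefl
  (@boxes_setI k m) (fun=> @boxesT k m)) => //.
- by rewrite bigcup_const.
- by move=> _ [B mB <-]; exact: etrans (PX' _ mB) (esym (PX _ mB)).
- move=> _ /=; apply: (@le_lt_trans _ _ 1%E); last exact: ltry.
  by rewrite /pushforward preimage_setT probability_setT.
Qed.
End GaussianLaw.

(** The nonnegative integral is a supremum over the simple functions below the integrand, and these
    grow with it. The form for arbitrary functions applies directly to iterated integrals. *)
Lemma ge0_le_integralW d (T : measurableType d) (R : realType)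
    (mu : {measure set T -> \bar R}) (f g : T -> \bar R) :
  (forall x, 0 <= f x)%E -> (forall x, f x <= g x)%E ->
  (\int[mu]_x f x <= \int[mu]_x g x)%E.
Proof.
move=> f0 fg.
have g0 x : (0 <= g x)%E by exact: le_trans (f0 x) (fg x).
rewrite !ge0_integralTE//.
apply: ge_ereal_sup => _ [h hf <-]; apply: ereal_sup_ubound.
by exists h => // x; exact: le_trans (hf x) (fg x).
Qed.

(** * Measurability of matrix operations *)

Section MxMeasurable.
Context (R : realType) d (T : measurableType d).
Implicit Types (k m n : nat).

Lemma mx_measurable_cst k m (A : 'M[R]_(k, m)) : mx_measurable (fun _ : T => A).
Proof. by move=> i j; exact: measurable_cst. Qed.

Lemma mx_measurableD k m (X Y : T -> 'M[R]_(k, m)) :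
  mx_measurable X -> mx_measurable Y -> mx_measurable (fun w => X w + Y w).
Proof.
move=> mX mY i j.
rewrite (_ : (fun w => _) = (fun w => X w i j) \+ (fun w => Y w i j)).
  exact: measurable_funD.
by apply/funext => w; rewrite mxE.
Qed.

Lemma mx_measurableZ k m (f : T -> R) (X : T -> 'M[R]_(k, m)) :
  measurable_fun setT f -> mx_measurable X ->
  mx_measurable (fun w => f w *: X w).
Proof.
move=> mf mX i j.
rewrite (_ : (fun w => _) = f \* (fun w => X w i j)); first exact: measurable_funM.
by apply/funext => w; rewrite mxE.
Qed.

Lemma mx_measurableN k m (X : T -> 'M[R]_(k, m)) :
  mx_measurable X -> mx_measurable (fun w => - X w).
Proof.
move=> mX i j.
rewrite (_ : (fun w => _) = \- (fun w => X w i j)); first exact: measurable_funN.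
by apply/funext => w; rewrite mxE.
Qed.

Lemma mx_measurableB k m (X Y : T -> 'M[R]_(k, m)) :
  mx_measurable X -> mx_measurable Y -> mx_measurable (fun w => X w - Y w).
Proof. by move=> mX mY; apply: mx_measurableD => //; exact: mx_measurableN. Qed.

Lemma mx_measurableM k m n (X : T -> 'M[R]_(k, m)) (Y : T -> 'M[R]_(m, n)) :
  mx_measurable X -> mx_measurable Y -> mx_measurable (fun w => X w *m Y w).
Proof.
move=> mX mY i j.
rewrite (_ : (fun w => _) = (fun w => \sum_l X w i l * Y w l j)).
  by apply: measurable_sum => l; exact: measurable_funM.
by apply/funext => w; rewrite mxE.
Qed.

Lemma mx_measurable_tr k m (X : T -> 'M[R]_(k, m)) :
  mx_measurable X -> mx_measurable (fun w => (X w)^T).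
Proof.
move=> mX i j; rewrite (_ : (fun w => _) = (fun w => X w j i)) //.
by apply/funext => w; rewrite mxE.
Qed.

Lemma mx_measurable_usub a b m (X : T -> 'M[R]_(a + b, m)) :
  mx_measurable X -> mx_measurable (fun w => usubmx (X w)).
Proof.
move=> mX i j; rewrite (_ : (fun w => _) = (fun w => X w (lshift b i) j)) //.
by apply/funext => w; rewrite mxE.
Qed.

Lemma mx_measurable_dsub a b m (X : T -> 'M[R]_(a + b, m)) :
  mx_measurable X -> mx_measurable (fun w => dsubmx (X w)).
Proof.
move=> mX i j; rewrite (_ : (fun w => _) = (fun w => X w (rshift a i) j)) //.
by apply/funext => w; rewrite mxE.
Qed.

Lemma mx_measurable_col a b m (X : T -> 'M[R]_(a, m)) (Y : T -> 'M[R]_(b, m)) :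
  mx_measurable X -> mx_measurable Y ->
  mx_measurable (fun w => col_mx (X w) (Y w)).
Proof.
move=> mX mY i j; case: (fintype.split_ordP i) => l ->.
  rewrite (_ : (fun w => _) = (fun w => X w l j)) //.
  by apply/funext => w; rewrite col_mxEu.
rewrite (_ : (fun w => _) = (fun w => Y w l j)) //.
by apply/funext => w; rewrite col_mxEd.
Qed.

End MxMeasurable.

Lemma mx_measurable_comp (R : realType) d (T : measurableType d) d'
    (T' : measurableType d') k m (X : T' -> 'M[R]_(k, m)) (p : T -> T') :
  measurable_fun setT p -> mx_measurable X -> mx_measurable (fun w => X (p w)).
Proof. by move=> mp mX i j; exact: (measurableT_comp (mX i j) mp). Qed.

Section StdGaussian.
Context (R : realType).

Definition borel_map k m k' m' (f : 'M[R]_(k, m) -> 'M[R]_(k', m')) :=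
  forall d (T : measurableType d) (X : T -> 'M[R]_(k, m)),
    mx_measurable X -> mx_measurable (fun w => f (X w)).

Lemma box_col_mx a b m (x : 'M[R]_(a, m)) (y : 'M[R]_(b, m)) (B : 'M[set R]_(a + b, m)) :
  box B (col_mx x y) <-> box (usubmx B) x /\ box (dsubmx B) y.
Proof.
split=> [H|[H1 H2] i j].
  by split=> i j; rewrite mxE; [have := H (lshift b i) j|have := H (rshift a i) j];
     rewrite ?col_mxEu ?col_mxEd.
case: (fintype.split_ordP i) => l ->; rewrite ?col_mxEu ?col_mxEd.
  by have := H1 l j; rewrite mxE.
by have := H2 l j; rewrite mxE.
Qed.

Lemma boxE_col_mx a b m (x : 'M[R]_(a + b, m)) (B : 'M[set R]_(a, m))
    (C : 'M[set R]_(b, m)) :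
  box (col_mx B C) x <-> box B (usubmx x) /\ box C (dsubmx x).
Proof. by rewrite -{1}[x]vsubmxK box_col_mx col_mxKu col_mxKd. Qed.

Lemma box_setT k m (x : 'M[R]_(k, m)) : box (const_mx setT) x.
Proof. by move=> i j; rewrite mxE. Qed.

Lemma std_gaussian_tr d (T : measurableType d) (P : probability T R) k m
    (X : T -> 'M[R]_(k, m)) :
  std_gaussian P X -> std_gaussian P (fun w => (X w)^T).
Proof.
move=> [mX PX]; split; first exact: mx_measurable_tr.
move=> B mB; rewrite exchange_big /=.
rewrite (_ : _ @^-1` _ = X @^-1` box B^T); last first.
  by apply/seteqP; split=> w /= H i j; have := H j i; rewrite !mxE.
apply: etrans (PX _ _) _; first by move=> i j; rewrite mxE.
by apply: eq_bigr => i _; apply: eq_bigr => j _; rewrite mxE.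
Qed.

Lemma std_gaussian_usub d (T : measurableType d) (P : probability T R) a b m
    (X : T -> 'M[R]_(a + b, m)) :
  std_gaussian P X -> std_gaussian P (fun w => usubmx (X w)).
Proof.
move=> [mX PX]; split; first exact: mx_measurable_usub.
move=> B mB.
rewrite (_ : _ @^-1` _ = X @^-1` box (col_mx B (const_mx setT))); last first.
  apply/seteqP; split=> w /=; last by case/boxE_col_mx.
  by move=> H; apply/boxE_col_mx; split => //; exact: box_setT.
apply: etrans (PX _ _) _.
  by move=> i j; rewrite mxE; case: fintype.split => l //; rewrite mxE.
rewrite big_split_ord /= [X in (_ * X)%E]big1 ?mule1.
  by apply: eq_bigr => i _; apply: eq_bigr => j _; rewrite col_mxEu.
by move=> i _; rewrite big1// => j _; rewrite col_mxEd mxE probability_setT.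
Qed.

Lemma std_gaussian_dsub d (T : measurableType d) (P : probability T R) a b m
    (X : T -> 'M[R]_(a + b, m)) :
  std_gaussian P X -> std_gaussian P (fun w => dsubmx (X w)).
Proof.
move=> [mX PX]; split; first exact: mx_measurable_dsub.
move=> B mB.
rewrite (_ : _ @^-1` _ = X @^-1` box (col_mx (const_mx setT) B)); last first.
  apply/seteqP; split=> w /=; last by case/boxE_col_mx.
  by move=> H; apply/boxE_col_mx; split => //; exact: box_setT.
apply: etrans (PX _ _) _.
  by move=> i j; rewrite mxE; case: fintype.split => l //; rewrite mxE.
rewrite big_split_ord /= [X in (X * _)%E]big1 ?mul1e.
  by apply: eq_bigr => i _; apply: eq_bigr => j _; rewrite col_mxEd.
by move=> i _; rewrite big1// => j _; rewrite col_mxEu mxE probability_setT.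
Qed.

Lemma std_gaussian_lsub d (T : measurableType d) (P : probability T R) a b m
    (X : T -> 'M[R]_(m, a + b)) :
  std_gaussian P X -> std_gaussian P (fun w => lsubmx (X w)).
Proof.
move=> /std_gaussian_tr/std_gaussian_usub/std_gaussian_tr.
by under [X in std_gaussian P X -> _]funext do rewrite -trmx_lsub trmxK.
Qed.

Lemma std_gaussian_rsub d (T : measurableType d) (P : probability T R) a b m
    (X : T -> 'M[R]_(m, a + b)) :
  std_gaussian P X -> std_gaussian P (fun w => rsubmx (X w)).
Proof.
move=> /std_gaussian_tr/std_gaussian_dsub/std_gaussian_tr.
by under [X in std_gaussian P X -> _]funext do rewrite -trmx_rsub trmxK.
Qed.

Lemma std_gaussian_prod d (T : measurableType d) (P : probability T R)
    d' (T' : measurableType d') (P' : probability T' R) a b m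
    (X : T -> 'M[R]_(a, m)) (Y : T' -> 'M[R]_(b, m)) :
  std_gaussian P X -> std_gaussian P' Y ->
  std_gaussian (P \x P')%E (fun z => col_mx (X z.1) (Y z.2)).
Proof.
move=> [mX PX] [mY PY]; split.
  by apply: mx_measurable_col; exact: mx_measurable_comp.
move=> B mB.
rewrite (_ : _ @^-1` _ = (X @^-1` box (usubmx B)) `*` (Y @^-1` box (dsubmx B))); last first.
  by apply/seteqP; split=> -[w w'] /box_col_mx.
have mBu i j : measurable (usubmx B i j) by rewrite mxE.
have mBd i j : measurable (dsubmx B i j) by rewrite mxE.
rewrite product_measure1E; [|exact: measurable_box..].
rewrite [X in (X * _)%E](PX _ mBu) [X in (_ * X)%E](PY _ mBd) big_split_ord /=.
by congr (_ * _)%E; apply: eq_bigr => i _; apply: eq_bigr => j _; rewrite mxE.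
Qed.

(** The row blocks are independent: taken from two independent samples of T, they reassemble to a
    matrix with the law of X. *)
Lemma std_gaussian_split d (T : measurableType d) (P : probability T R) a b m
    (X : T -> 'M[R]_(a + b, m)) (F : 'M[R]_(a + b, m) -> \bar R) :
  std_gaussian P X -> borel_fun F -> (forall x, 0 <= F x)%E ->
  (\int[P]_w F (X w) =
   \int[P]_w \int[P]_w' F (col_mx (usubmx (X w)) (dsubmx (X w'))))%E.
Proof.
move=> sX mF F0.
have sZ := std_gaussian_prod (std_gaussian_usub sX) (std_gaussian_dsub sX).
rewrite (std_gaussian_law sX sZ mF F0).
rewrite (fubini_tonelli1 (fun z : T * T => F (col_mx (usubmx (X z.1)) (dsubmx (X z.2))))) //.
by apply: mF; case: sZ.
Qed.

Lemma std_gaussian_split_row d (T : measurableType d) (P : probability T R) a b m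
    (X : T -> 'M[R]_(m, a + b)) (F : 'M[R]_(m, a + b) -> \bar R) :
  std_gaussian P X -> borel_fun F -> (forall x, 0 <= F x)%E ->
  (\int[P]_w F (X w) =
   \int[P]_w \int[P]_w' F (row_mx (lsubmx (X w)) (rsubmx (X w'))))%E.
Proof.
move=> sX mF F0.
transitivity (\int[P]_w F (((X w)^T)^T))%E.
  by apply: eq_integral => w _; rewrite trmxK.
rewrite (std_gaussian_split (std_gaussian_tr sX) (F := fun x => F x^T)) //.
  apply: eq_integral => w _; apply: eq_integral => w' _.
  by rewrite tr_col_mx -trmx_lsub -trmx_rsub !trmxK.
by move=> d' T' Y mY; apply: mF; exact: mx_measurable_tr.
Qed.

Lemma borel_box k m k' m' (f : 'M[R]_(k, m) -> 'M[R]_(k', m')) (B : 'M[set R]_(k', m')) :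
  borel_map f -> (forall i j, measurable (B i j)) ->
  borel_fun (fun x => (\1_(box B) (f x))%:E).
Proof.
move=> mf mB d T X mX; apply/measurable_EFinP.
rewrite (_ : (fun w => _) = \1_((fun w => f (X w)) @^-1` box B)); last first.
  by apply/funext => w; rewrite !indicE.
by apply: measurable_indic; apply: measurable_box => //; exact: mf.
Qed.

(** On the product space the two images are independent, and the stacked image has the same law
    there as on T. This is what makes block-diagonal orthogonal matrices preserve Gaussian
    vectors. *)
Lemma std_gaussian_map d (T : measurableType d) (P : probability T R) a b m a' b' m'
    (X : T -> 'M[R]_(a + b, m)) (f : 'M[R]_(a, m) -> 'M[R]_(a', m'))
    (g : 'M[R]_(b, m) -> 'M[R]_(b', m')) :
  std_gaussian P X -> borel_map f -> borel_map g ->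
  std_gaussian P (fun w => f (usubmx (X w))) ->
  std_gaussian P (fun w => g (dsubmx (X w))) ->
  std_gaussian P (fun w => col_mx (f (usubmx (X w))) (g (dsubmx (X w)))).
Proof.
move=> sX mf mg sf sg.
have [mX _] := sX.
pose h (x : 'M[R]_(a + b, m)) := col_mx (f (usubmx x)) (g (dsubmx x)).
have mh : borel_map h.
  move=> d' T' Y mY; apply: mx_measurable_col; [apply: mf|apply: mg].
    exact: mx_measurable_usub.
  exact: mx_measurable_dsub.
split; first exact: mh.
move=> B mB.
have sZ := std_gaussian_prod sf sg.
have [_ <- //] := sZ.
have sW := std_gaussian_prod (std_gaussian_usub sX) (std_gaussian_dsub sX).
have mb := borel_box mh mB.
have b0 (x : 'M[R]_(a + b, m)) : (0 <= (\1_(box B) (h x) : R)%:E)%E.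
  by rewrite lee_fin.
have := std_gaussian_law sX sW mb b0.
under eq_integral do rewrite -[\1__ _]/(\1_((fun w => h (X w)) @^-1` box B) _).
rewrite integral_indic // ?setIT; last by apply: measurable_box => //; exact: mh.
move=> ->.
transitivity (\int[(P \x P)%E]_z
  (\1_((fun z : T * T => h (col_mx (usubmx (X z.1)) (dsubmx (X z.2)))) @^-1` box B) z)%:E)%E.
  by apply: eq_integral => z _.
rewrite integral_indic // ?setIT; last first.
  by apply: measurable_box => //; apply: mh; case: sW.
congr ((P \x P)%E _); apply/seteqP; split=> z /=; rewrite /h col_mxKu col_mxKd //.
Qed.

End StdGaussian.

(** * Rotation invariance *)

Section Rotation2D.
Context (R : realType).
Notation mu := (@lebesgue_measure R).
Notation gauss := (@normal_prob R 0 1).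

Lemma integral_normal_prob01 (f : R -> \bar R) :
  measurable_fun setT f -> (forall x, 0 <= f x)%E ->
  (\int[gauss]_x f x = \int[mu]_x (f x * (normal_pdf 0 1 x)%:E))%E.
Proof.
move=> mf f0.
have dom : gauss `<< mu by exact: normal_prob_dominates.
rewrite -(@Radon_Nikodym_SigmaFinite.change_of_variables _ _ _ gauss mu dom f)//.
apply: ae_eq_integral => //.
- apply: emeasurable_funM => //.
  exact: measurable_int (Radon_Nikodym_SigmaFinite.f_integrable dom).
- apply: emeasurable_funM => //; apply/measurable_EFinP.
  exact: measurable_normal_pdf.
(* The Radon-Nikodym derivative and the density have the same integral over every measurable set,
   hence agree almost everywhere. *)
- apply: ae_eqe_mul2l.
  apply: integral_ae_eq => //.
  + exact: Radon_Nikodym_SigmaFinite.f_integrable.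
  + by apply/measurable_EFinP; exact: measurable_normal_pdf.
  + by move=> E _ mE; rewrite -Radon_Nikodym_SigmaFinite.f_integral.
Qed.

Lemma lebesgue_measure_shift (a : R) (A : set R) : measurable A ->
  pushforward mu (fun x : measurableTypeR R => ((x + a)%R : measurableTypeR R)) A = mu A.
Proof.
move=> mA; apply/esym.
have ms : measurable_fun setT (fun x : measurableTypeR R => ((x + a)%R : measurableTypeR R)).
  by apply: measurable_funD => //; exact: measurable_cst.
apply: (@lebesgue_measure_unique R (pushforward mu _)) => //= _ [[u v]] _ <-.
rewrite /pushforward.
rewrite (_ : _ @^-1` _ = `]u - a, v - a]%classic); last first.
  by apply/seteqP; split=> x /=; rewrite !in_itv/= ltrBlDr lerBrDr.
by rewrite !lebesgue_measure_itv/= !lte_fin ltrD2r -!EFinB opprB addrA subrK.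
Qed.

Lemma integral_lebesgue_shift (a : R) (f : R -> \bar R) :
  measurable_fun setT f -> (forall x, 0 <= f x)%E ->
  (\int[mu]_x f (x + a)%R = \int[mu]_x f x)%E.
Proof.
move=> mf f0.
have ms : measurable_fun setT (fun x : measurableTypeR R => ((x + a)%R : measurableTypeR R)).
  by apply: measurable_funD => //; exact: measurable_cst.
transitivity (\int[pushforward mu
  (fun x : measurableTypeR R => ((x + a)%R : measurableTypeR R))]_x f x)%E.
  by rewrite (ge0_integral_pushforward ms).
by apply: eq_measure_integral => A mA _; exact: lebesgue_measure_shift.
Qed.

Lemma integral_lebesgue_opp (f : R -> \bar R) :
  measurable_fun setT f -> (forall x, 0 <= f x)%E ->
  (\int[mu]_x f (- x)%R = \int[mu]_x f x)%E.
Proof.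
move=> mf f0.
have ms : measurable_fun setT (-%R : measurableTypeR R -> measurableTypeR R).
  exact: oppr_measurable.
transitivity (\int[pushforward mu (-%R : measurableTypeR R -> measurableTypeR R)]_x f x)%E.
  by rewrite (ge0_integral_pushforward ms).
by apply: eq_measure_integral => A mA _; exact: lebesgue_measureN.
Qed.

Lemma measurable_shear_y (a : R) :
  measurable_fun setT (fun z : R * R => (z.1, z.2 + a * z.1)).
Proof.
apply: measurable_fun_pair; first exact: measurable_fst.
by apply: measurable_funD => //; exact: measurable_funM.
Qed.

Lemma measurable_shear_x (a : R) :
  measurable_fun setT (fun z : R * R => (z.1 + a * z.2, z.2)).
Proof.
apply: measurable_fun_pair; last exact: measurable_snd.
by apply: measurable_funD => //; exact: measurable_funM.
Qed.

Definition plane_int (f : R * R -> \bar R) := (\int[mu]_x \int[mu]_y f (x, y))%E.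

Lemma plane_int_shear_y (a : R) (f : R * R -> \bar R) :
  measurable_fun setT f -> (forall z, 0 <= f z)%E ->
  plane_int (fun z => f (z.1, z.2 + a * z.1)%R) = plane_int f.
Proof.
move=> mf f0; apply: eq_integral => x _ /=.
apply: (@integral_lebesgue_shift _ (fun y => f (x, y))) => //.
exact: measurableT_comp mf (measurable_pair1 x).
Qed.

Lemma plane_int_shear_x (a : R) (f : R * R -> \bar R) :
  measurable_fun setT f -> (forall z, 0 <= f z)%E ->
  plane_int (fun z => f (z.1 + a * z.2, z.2)%R) = plane_int f.
Proof.
move=> mf f0; rewrite /plane_int.
apply: etrans (@fubini_tonelli _ _ _ _ _ mu mu
  (fun z => f (z.1 + a * z.2, z.2)%R) _ (fun=> f0 _)) _.
  exact: measurableT_comp mf (measurable_shear_x a).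
apply: etrans _ (esym (@fubini_tonelli _ _ _ _ _ mu mu f mf f0)).
apply: eq_integral => y _ /=.
apply: (@integral_lebesgue_shift _ (fun x => f (x, y))) => //.
exact: measurableT_comp mf (measurable_pair2 y).
Qed.

(* A rotation by an angle that is not a multiple of pi is a product of three shears. *)
Lemma plane_int_rotation (c s : R) (f : R * R -> \bar R) :
  c ^+ 2 + s ^+ 2 = 1 -> s != 0 ->
  measurable_fun setT f -> (forall z, 0 <= f z)%E ->
  plane_int (fun z => f (c * z.1 - s * z.2, s * z.1 + c * z.2)%R) = plane_int f.
Proof.
move=> cs s0 mf f0.
(* With c = cos theta and s = sin theta this is -tan(theta/2): the rotation is a shear by a, a shear
   by s in the other direction, and the shear by a again. *)
pose a := (c - 1) / s.
have sa : a * s = c - 1 by rewrite /a divfK.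
pose f1 (z : R * R) := f (z.1 + a * z.2, z.2)%R.
pose f2 (z : R * R) := f1 (z.1, z.2 + s * z.1)%R.
have mf1 : measurable_fun setT f1 by exact: measurableT_comp (measurable_shear_x _).
have mf2 : measurable_fun setT f2 by exact: measurableT_comp (measurable_shear_y _).
apply: etrans _ (plane_int_shear_x a mf f0).
apply: etrans _ (plane_int_shear_y s mf1 (fun=> f0 _)).
apply: etrans _ (plane_int_shear_x a mf2 (fun=> f0 _)).
congr plane_int; apply/funext => z; rewrite /f2 /f1 /=.
congr (f (_, _)).
  have e : s * a = c - 1 by rewrite mulrC.
  have e2 : a * (c + 1) = - s.
    apply: (mulIf s0); rewrite mulrAC sa.
    have s2 : s ^+ 2 = 1 - c ^+ 2 by rewrite -cs addrC addKr.
    by rewrite mulNr -expr2 s2; ring.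
  rewrite (_ : - (s * z.2) = a * (c + 1) * z.2); last by rewrite e2 mulNr.
  have -> : z.1 + a * z.2 + a * (z.2 + s * (z.1 + a * z.2)) =
     z.1 + (a * s) * z.1 + a * 2 * z.2 + a * (a * s) * z.2 by ring.
  by rewrite sa; ring.
have -> : z.2 + s * (z.1 + a * z.2) = s * z.1 + z.2 + (a * s) * z.2 by ring.
by rewrite sa; ring.
Qed.

Lemma normal_pdf01E (x : R) :
  normal_pdf 0 1 x = normal_peak 1 * expR (- (x ^+ 2) / 2).
Proof.
by rewrite normal_pdfE ?oner_neq0// /normal_fun subr0 expr1n.
Qed.

Lemma integral_gauss2 (f : R * R -> \bar R) :
  measurable_fun setT f -> (forall z, 0 <= f z)%E ->
  (\int[gauss \x gauss]_z f z =
   plane_int (fun z => f z * (normal_pdf 0 1 z.1 * normal_pdf 0 1 z.2)%:E))%E.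
Proof.
move=> mf f0.
apply: etrans (@fubini_tonelli1 _ _ _ _ _ gauss gauss f mf f0) _; rewrite /fubini_F.
rewrite integral_normal_prob01; last 2 first.
- exact: measurable_fun_fubini_tonelli_F.
- by move=> x; apply: integral_ge0.
apply: eq_integral => x _ /=.
have mfx : measurable_fun setT (fun y => f (x, y)).
  exact: measurableT_comp mf (measurable_pair1 x).
rewrite integral_normal_prob01 // -ge0_integralZr //.
- by apply: eq_integral => y _; rewrite -muleA -EFinM [normal_pdf _ _ y * _]mulrC.
- apply: emeasurable_funM => //; apply/measurable_EFinP.
  exact: measurable_normal_pdf.
- by move=> y _; rewrite mule_ge0 // lee_fin normal_pdf_ge0.
- by rewrite lee_fin normal_pdf_ge0.
Qed.

(** The product density depends only on z.1^2 + z.2^2, so the invariance of the plane integral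
    carries over. *)
Lemma integral_gauss2_rotation (c s : R) (f : R * R -> \bar R) :
  c ^+ 2 + s ^+ 2 = 1 -> s != 0 ->
  measurable_fun setT f -> (forall z, 0 <= f z)%E ->
  (\int[gauss \x gauss]_z f (c * z.1 - s * z.2, s * z.1 + c * z.2)%R =
   \int[gauss \x gauss]_z f z)%E.
Proof.
move=> cs s0 mf f0.
have mrot : measurable_fun setT
    (fun z : R * R => (c * z.1 - s * z.2, s * z.1 + c * z.2)).
  apply: measurable_fun_pair.
    by apply: measurable_funB; exact: measurable_funM.
  by apply: measurable_funD; exact: measurable_funM.
pose g (z : R * R) := (f z * (normal_pdf 0 1 z.1 * normal_pdf 0 1 z.2)%:E)%E.
have mg : measurable_fun setT g.
  apply: emeasurable_funM => //; apply/measurable_EFinP.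
  by apply: measurable_funM; apply: measurableT_comp => //; exact: measurable_normal_pdf.
have g0 z : (0 <= g z)%E by rewrite mule_ge0// lee_fin mulr_ge0 ?normal_pdf_ge0.
have mfr := measurableT_comp mf mrot.
apply: etrans (integral_gauss2 mfr (fun=> f0 _)) _.
apply: etrans _ (esym (integral_gauss2 mf f0)).
apply: etrans _ (plane_int_rotation cs s0 mg g0).
congr plane_int; apply/funext => z; rewrite /g /=; congr (_ * _%:E)%E.
rewrite !normal_pdf01E mulrACA -expRD [RHS]mulrACA -expRD.
congr (_ * expR _).
have -> : - (c * z.1 - s * z.2) ^+ 2 / 2 + - (s * z.1 + c * z.2) ^+ 2 / 2 =
   - ((c ^+ 2 + s ^+ 2) * (z.1 ^+ 2 + z.2 ^+ 2)) / 2 by field.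
by rewrite cs; field.
Qed.

Lemma gauss_opp (B : set R) : measurable B -> gauss (-%R @^-1` B) = gauss B.
Proof.
move=> mB.
have mN : measurable (-%R @^-1` B : set R).
  by rewrite -[_ @^-1` _]setTI; exact: oppr_measurable.
have g A : measurable A -> gauss A = (\int[mu]_x ((\1_A x)%:E * (normal_pdf 0 1 x)%:E))%E.
  move=> mA; rewrite -integral_normal_prob01.
  - by rewrite integral_indic// setIT.
  - by apply/measurable_EFinP; exact: measurable_indic.
  - by move=> x; rewrite lee_fin.
rewrite g // (g B) // -[RHS]integral_lebesgue_opp.
- apply: eq_integral => x _; rewrite !normal_pdf01E sqrrN; congr (_%:E * _)%E.
- apply: emeasurable_funM; apply/measurable_EFinP; first exact: measurable_indic.
  exact: measurable_normal_pdf.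
- by move=> x; rewrite mule_ge0 // lee_fin ?normal_pdf_ge0.
Qed.

End Rotation2D.

Section GaussianRotation.
Context (R : realType).
Notation gauss := (@normal_prob R 0 1).

(** Converse of [std_gaussian_law]: box indicators are enough as test functions. *)
Lemma std_gaussian_of_law d (T : measurableType d) (P : probability T R)
    d' (T' : measurableType d') (P' : probability T' R) k m
    (X : T -> 'M[R]_(k, m)) (Y : T' -> 'M[R]_(k, m)) :
  std_gaussian P X -> mx_measurable Y ->
  (forall F, borel_fun F -> (forall x, 0 <= F x)%E ->
     (\int[P']_w F (Y w) = \int[P]_w F (X w))%E) ->
  std_gaussian P' Y.
Proof.
move=> [mX PX] mY E; split=> // B mB; rewrite -PX //.
have mb : borel_fun (fun x => (\1_(box B) x : R)%:E).
  exact: (@borel_box _ _ _ _ _ id).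
have := E _ mb (fun x => _).
under eq_integral do rewrite -[\1__ _]/(\1_(Y @^-1` box B) _).
under [in RHS]eq_integral do rewrite -[\1__ _]/(\1_(X @^-1` box B) _).
rewrite !integral_indic ?setIT//; [|exact: measurable_box..].
by apply => x; rewrite lee_fin.
Qed.

Lemma std_gaussian_scalar : std_gaussian gauss (fun x : R => x%:M : 'M[R]_1).
Proof.
split=> [i j|B mB].
  rewrite (_ : (fun w => _) = id); first by move=> _ A mA; rewrite setTI preimage_id.
  by apply/funext => x; rewrite !ord1 mxE eqxx.
rewrite !big_ord1; congr (gauss _); apply/seteqP; split => x /=.
  by move=> /(_ 0 0); rewrite mxE.
by move=> H i j; rewrite !ord1 mxE.
Qed.

Definition rot_mx (c s : R) : 'M[R]_(1 + 1) :=
  block_mx c%:M (- s)%:M s%:M c%:M.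

Lemma std_gaussian_rot d (T : measurableType d) (P : probability T R)
    (X : T -> 'M[R]_(1 + 1, 1)) (c s : R) :
  c ^+ 2 + s ^+ 2 = 1 -> s != 0 ->
  std_gaussian P X -> std_gaussian P (fun w => rot_mx c s *m X w).
Proof.
move=> cs s0 sX.
have mr d' (T' : measurableType d') (Y : T' -> 'M[R]_(1 + 1, 1)) :
    mx_measurable Y -> mx_measurable (fun w => rot_mx c s *m Y w).
  by apply: mx_measurableM; exact: mx_measurable_cst.
apply: (std_gaussian_of_law sX); first by apply: mr; case: sX.
move=> F mF F0.
have sZ := std_gaussian_prod std_gaussian_scalar std_gaussian_scalar.
have [mZ _] := sZ.
rewrite (std_gaussian_law sX sZ (F := fun x => F (rot_mx c s *m x))) //; last first.
  by move=> d' T' Y mY; apply: mF; exact: mr.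
rewrite (std_gaussian_law sX sZ mF F0).
rewrite -(integral_gauss2_rotation cs s0 (f := fun z => F (col_mx z.1%:M z.2%:M))) //.
  apply: eq_integral => z _; congr F.
  rewrite /rot_mx mul_block_col -!scalar_mxM -!raddfD /=.
  by congr (col_mx _%:M _%:M); rewrite mulNr.
exact: mF.
Qed.
End GaussianRotation.

(** * Inner products and Householder reflections *)

Section Dot.
Context (R : realType).
Implicit Types (m n : nat).

Definition dot n (x y : 'cV[R]_n) : R := (x^T *m y) 0 0.

Lemma dotE n (x y : 'cV[R]_n) : dot x y = \sum_i x i 0 * y i 0.
Proof. by rewrite /dot mxE; apply: eq_bigr => i _; rewrite mxE. Qed.

Lemma dot_scalar n (x y : 'cV[R]_n) : x^T *m y = (dot x y)%:M.
Proof. exact: mx11_scalar. Qed.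

Lemma dotC n (x y : 'cV[R]_n) : dot x y = dot y x.
Proof. by rewrite !dotE; apply: eq_bigr => i _; rewrite mulrC. Qed.

Lemma dotDl n (x y z : 'cV[R]_n) : dot (x + y) z = dot x z + dot y z.
Proof. by rewrite /dot linearD /= mulmxDl mxE. Qed.

Lemma dotDr n (x y z : 'cV[R]_n) : dot x (y + z) = dot x y + dot x z.
Proof. by rewrite /dot mulmxDr mxE. Qed.

Lemma dotZl n a (x z : 'cV[R]_n) : dot (a *: x) z = a * dot x z.
Proof. by rewrite /dot linearZ /= -scalemxAl mxE. Qed.

Lemma dotZr n a (x z : 'cV[R]_n) : dot x (a *: z) = a * dot x z.
Proof. by rewrite /dot -scalemxAr mxE. Qed.

Lemma dotNl n (x z : 'cV[R]_n) : dot (- x) z = - dot x z.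
Proof. by rewrite -scaleN1r dotZl mulN1r. Qed.

Lemma dotNr n (x z : 'cV[R]_n) : dot x (- z) = - dot x z.
Proof. by rewrite -scaleN1r dotZr mulN1r. Qed.

Lemma dotBl n (x y z : 'cV[R]_n) : dot (x - y) z = dot x z - dot y z.
Proof. by rewrite dotDl dotNl. Qed.

Lemma dotBr n (x y z : 'cV[R]_n) : dot x (y - z) = dot x y - dot x z.
Proof. by rewrite dotDr dotNr. Qed.

Lemma dot0l n (z : 'cV[R]_n) : dot 0 z = 0.
Proof. by rewrite /dot trmx0 mul0mx mxE. Qed.

Lemma dot0r n (z : 'cV[R]_n) : dot z 0 = 0.
Proof. by rewrite dotC dot0l. Qed.

Lemma dot_mull m n (A : 'M[R]_(m, n)) x y : dot (A *m x) y = dot x (A^T *m y).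
Proof. by rewrite /dot trmx_mul mulmxA. Qed.

Lemma dot_ge0 n (x : 'cV[R]_n) : 0 <= dot x x.
Proof. by rewrite dotE; apply: sumr_ge0 => i _; rewrite -expr2 sqr_ge0. Qed.

Lemma dot_eq0 n (x : 'cV[R]_n) : (dot x x == 0) = (x == 0).
Proof.
apply/idP/eqP => [|->]; last by rewrite dot0l.
rewrite dotE psumr_eq0 => [/allP H|i _]; last by rewrite -expr2 sqr_ge0.
apply/colP => i; have := H i (mem_index_enum i).
by rewrite /= -expr2 sqrf_eq0 mxE => /eqP.
Qed.

Lemma dot_col_mx m n (x y : 'cV[R]_(m + n)) :
  dot x y = dot (usubmx x) (usubmx y) + dot (dsubmx x) (dsubmx y).
Proof.
by rewrite !dotE big_split_ord /=; congr (_ + _); apply: eq_bigr => i _; rewrite !mxE.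
Qed.

Lemma dot_delta n (x : 'cV[R]_n) i : dot (delta_mx i 0) x = x i 0.
Proof.
rewrite dotE (bigD1 i) //= mxE !eqxx mul1r big1 ?addr0 // => j /negbTE ji.
by rewrite mxE ji mul0r.
Qed.

Lemma dot_isometry m n (A : 'M[R]_(m, n)) x y :
  A^T *m A = 1%:M -> dot (A *m x) (A *m y) = dot x y.
Proof. by move=> AA; rewrite dot_mull mulmxA AA mul1mx. Qed.

(* For a = b this is the identity, thanks to 2 / 0 = 0. *)
Definition householder n (a b : 'cV[R]_n) : 'M[R]_n :=
  1%:M - (2 / dot (a - b) (a - b)) *: ((a - b) *m (a - b)^T).

Lemma householder_tr n (a b : 'cV[R]_n) : (householder a b)^T = householder a b.
Proof. by rewrite /householder linearB /= trmx1 linearZ /= trmx_mul trmxK. Qed.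

Lemma householder_sqr n (a b : 'cV[R]_n) : householder a b *m householder a b = 1%:M.
Proof.
rewrite /householder; set h := a - b.
have [h0|h0] := eqVneq (dot h h) 0.
  by rewrite h0 invr0 mulr0 scale0r subr0 mulmx1.
set K := h *m h^T; set t := 2 / dot h h.
have KK : K *m K = dot h h *: K.
  by rewrite -mulmxA [h^T *m _]mulmxA dot_scalar mul_scalar_mx -scalemxAr.
rewrite mulmxBl mul1mx mulmxBr mulmx1 -scalemxAl -scalemxAr KK !scalerA.
have -> : t * t * dot h h = t + t by rewrite /t; field.
by rewrite scalerDl opprB addrK subrK.
Qed.

Lemma householder_orth n (a b : 'cV[R]_n) : (householder a b)^T *m householder a b = 1%:M.
Proof. by rewrite householder_tr householder_sqr. Qed.

(** Equal norms give |a - b|^2 = 2 <a - b, a>, so the reflection subtracts exactly a - b from a. *)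
Lemma householderE n (a b : 'cV[R]_n) : dot a a = dot b b -> householder a b *m a = b.
Proof.
move=> ab; rewrite /householder mulmxBl mul1mx -scalemxAl -mulmxA dot_scalar.
have e : dot (a - b) (a - b) = 2 * dot (a - b) a.
  by rewrite !dotBl !dotBr -ab (dotC b a); ring.
have [h0|h0] := eqVneq (dot (a - b) (a - b)) 0.
  move: (h0); move/eqP; rewrite dot_eq0 subr_eq0 => /eqP ->.
  by rewrite subrr mul0mx scaler0 subr0.
rewrite mul_mx_scalar scalerA.
have -> : 2 / dot (a - b) (a - b) * dot (a - b) a = 1.
  by rewrite mulrAC -e divff.
by rewrite scale1r opprB addrC subrK.
Qed.

End Dot.

(** * Orthogonal invariance of Gaussian vectors and matrices *)

Section Rotation.
Context (R : realType).

Definition gaussian_invariant n (A : 'M[R]_n) :=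
  forall d (T : measurableType d) (P : probability T R) (X : T -> 'cV[R]_n),
    std_gaussian P X -> std_gaussian P (fun w => A *m X w).

Lemma borel_mulmx k m n (A : 'M[R]_(k, m)) :
  borel_map (fun x : 'M[R]_(m, n) => A *m x).
Proof.
by move=> d T X mX; apply: mx_measurableM => //; exact: mx_measurable_cst.
Qed.

Lemma gaussian_invariantM n (A B : 'M[R]_n) :
  gaussian_invariant A -> gaussian_invariant B -> gaussian_invariant (A *m B).
Proof.
move=> iA iB d T P X sX; under [X in std_gaussian P X]funext do rewrite -mulmxA.
by apply: iA; exact: iB.
Qed.

Lemma gaussian_invariant1 n : gaussian_invariant (1%:M : 'M[R]_n).
Proof. by move=> d T P X sX; under [X in std_gaussian P X]funext do rewrite mul1mx. Qed.

Lemma gaussian_invariant_block m n (A : 'M[R]_m) (B : 'M[R]_n) :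
  gaussian_invariant A -> gaussian_invariant B ->
  gaussian_invariant (block_mx A 0 0 B).
Proof.
move=> iA iB d T P X sX.
have := std_gaussian_map sX (@borel_mulmx _ _ _ A) (@borel_mulmx _ _ _ B)
  (iA _ _ _ _ (std_gaussian_usub sX)) (iB _ _ _ _ (std_gaussian_dsub sX)).
congr (std_gaussian P _); apply/funext => w.
by rewrite -[in RHS](vsubmxK (X w)) mul_block_col !mul0mx addr0 add0r.
Qed.

Lemma gaussian_invariant_rot (c s : R) :
  c ^+ 2 + s ^+ 2 = 1 -> s != 0 -> gaussian_invariant (rot_mx c s).
Proof. by move=> cs s0 d T P X; exact: std_gaussian_rot. Qed.

Lemma gaussian_invariant_sign (a : 'M[R]_1) : a^T *m a = 1%:M -> gaussian_invariant a.
Proof.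
move=> aa d T P X sX.
have : a 0 0 ^+ 2 = 1.
  have := congr1 (fun M : 'M[R]_1 => M 0 0) aa.
  by rewrite !mxE big_ord1 mxE -expr2.
move/eqP; rewrite sqrf_eq1 => /orP[] /eqP a1.
  rewrite [a]mx11_scalar a1; exact: gaussian_invariant1.
have [mX PX] := sX.
rewrite [a]mx11_scalar a1.
split; first by apply: mx_measurableM => //; exact: mx_measurable_cst.
move=> B mB.
have mN i j : measurable (-%R @^-1` B i j : set R).
  by rewrite -[_ @^-1` _]setTI; exact: oppr_measurable.
rewrite (_ : _ @^-1` _ = X @^-1` box (\matrix_(i, j) (-%R @^-1` B i j))); last first.
  apply/seteqP; split=> w /= H i j; have := H i j;
    by rewrite !mxE big_ord1 !ord1 mxE eqxx mulN1r.
apply: etrans (PX _ _) _; first by move=> i j; rewrite mxE.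
by rewrite !big_ord1 mxE gauss_opp.
Qed.

Definition givens n (a s : R) : 'M[R]_((1 + 1) + n) := block_mx (rot_mx a s) 0 0 1%:M.

Lemma givens_tr n a s : (givens n a s)^T = givens n a (- s).
Proof.
rewrite /givens tr_block_mx trmx1 !trmx0 /rot_mx tr_block_mx.
by rewrite !tr_scalar_mx opprK.
Qed.

Lemma givensK n a s : a ^+ 2 + s ^+ 2 = 1 -> givens n a s *m givens n a (- s) = 1%:M.
Proof.
move=> a2s2; rewrite /givens mulmx_block !mul0mx !mulmx0 !addr0 !add0r mulmx1.
rewrite /rot_mx mulmx_block -!scalar_mxM -!raddfD /= opprK.
have -> : a * a + - s * - s = 1 by rewrite -a2s2; ring.
have -> : s * s + a * a = 1 by rewrite -a2s2; ring.
have -> : a * s + - s * a = 0 by ring.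
have -> : s * a + a * - s = 0 by ring.
by rewrite raddf0 -!scalar_mx_block.
Qed.

Lemma givens_mul n (a s : R) (x : 'cV[R]_((1 + 1) + n)) :
  a ^+ 2 + s ^+ 2 = 1 -> (forall i, x i 0 = a *+ (i == 0%N :> nat) + s *+ (i == 1%N :> nat)) ->
  givens n a (- s) *m x = delta_mx 0 0.
Proof.
move=> a2s2 xE; rewrite -[x]vsubmxK mul_block_col mul1mx !mul0mx addr0 add0r.
have -> : dsubmx x = 0 by apply/colP => i; rewrite !mxE xE /= addr0.
rewrite -[usubmx x]vsubmxK /rot_mx mul_block_col.
have -> : usubmx (usubmx x) = a%:M.
  by apply/matrixP => i j; rewrite !ord1 !mxE xE /= addr0.
have -> : dsubmx (usubmx x) = s%:M.
  by apply/matrixP => i j; rewrite !ord1 !mxE xE /= add0r.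
rewrite -!scalar_mxM -!raddfD /= opprK.
have -> : a * a + s * s = 1 by rewrite -a2s2; ring.
have -> : - s * a + a * s = 0 by ring.
apply/colP => i; rewrite [RHS]mxE eqxx andbT.
case: (fintype.split_ordP i) => l ->; rewrite ?col_mxEd ?col_mxEu.
  case: (fintype.split_ordP l) => l' ->; rewrite ?col_mxEd ?col_mxEu !ord1 mxE;
    by rewrite ?eqxx.
by rewrite mxE.
Qed.

(* Induction on the dimension: a Householder reflection of the last n
   coordinates followed by a plane rotation moves the first column of O to the
   first basis vector. *)
Lemma gaussian_invariant_orth n (O : 'M[R]_n) : O^T *m O = 1%:M -> gaussian_invariant O.
Proof.
elim: n O => [|n IH] O OO.
  move=> d T P X; congr (std_gaussian P _); apply/funext => w.
  by rewrite [RHS]flatmx0 [LHS]flatmx0.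
(* An orthogonal matrix that vanishes below its corner entry is block diagonal: the corner is a
   sign, and orthogonality forces the rest of the first row to vanish too. *)
have base (Q : 'M[R]_(1 + n)) : Q^T *m Q = 1%:M -> dlsubmx Q = 0 -> gaussian_invariant Q.
  rewrite -[Q]submxK block_mxKdl => + Q0; rewrite Q0.
  rewrite tr_block_mx mulmx_block trmx0 !mul0mx !mulmx0 !addr0 [1%:M](@scalar_mx_block _ 1 n).
  move=> /eq_block_mx[aa ab _ DD].
  have b0 : ursubmx Q = 0.
    have := congr1 (mulmx (ulsubmx Q)) ab.
    have aa' : ulsubmx Q *m (ulsubmx Q)^T = 1%:M by apply: mulmx1C.
    by rewrite mulmxA aa' mul1mx mulmx0.
  move: DD; rewrite b0 trmx0 mul0mx add0r => DD.
  apply: gaussian_invariant_block; [exact: gaussian_invariant_sign|exact: IH].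
pose c : 'cV[R]_(1 + n) := lsubmx (O : 'M[R]_(1 + n)).
have cc : dot c c = 1.
  transitivity ((1%:M : 'M[R]_(1 + n)) 0 0); last by rewrite mxE eqxx.
  rewrite -OO mxE dotE; apply: eq_bigr => i _; rewrite !mxE.
  by rewrite (_ : lshift n 0 = 0) //; apply: val_inj.
(* If c' = 0 the matrix already has the shape of [base]; otherwise [rho] is nonzero, as the plane
   rotation requires of its sine. *)
pose c' := dsubmx c; have [c0|c0] := eqVneq c' 0.
  apply: base => //; apply/matrixP => i j.
  by have /matrixP/(_ i j) := c0; rewrite !mxE.
case: n => [|n] in O OO IH base c cc c' c0 *.
  by rewrite [c']flatmx0 eqxx in c0.
pose rho := Num.sqrt (dot c' c').
have rho2 : rho ^+ 2 = dot c' c' by rewrite sqr_sqrtr // dot_ge0.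
have rho0 : rho != 0.
  by rewrite -sqrf_eq0 rho2 dot_eq0.
pose a := c 0 0.
have arho : a ^+ 2 + rho ^+ 2 = 1.
  rewrite rho2 -cc dot_col_mx; congr (_ + _).
  by rewrite dotE big_ord1 mxE -expr2; congr (c _ _ ^+ 2); apply: val_inj.
pose H' := householder c' (rho *: delta_mx 0 0).
have H'c : H' *m c' = rho *: delta_mx 0 0.
  apply: householderE; rewrite dotZl dotZr dot_delta mxE !eqxx mulr1 -rho2.
  by rewrite expr2.
pose M1 : 'M[R]_(1 + n.+1) := block_mx 1%:M 0 0 H'.
pose G (s : R) : 'M[R]_(1 + n.+1) := givens n a s.
have iM1 : gaussian_invariant M1.
  apply: gaussian_invariant_block; first exact: gaussian_invariant1.
  apply: IH; exact: householder_orth.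
have iG : gaussian_invariant (G rho).
  exact: (@gaussian_invariant_block (1 + 1) n _ _
    (gaussian_invariant_rot arho rho0) (@gaussian_invariant1 n)).
have M1M1 : M1 *m M1 = 1%:M.
  by rewrite mulmx_block !mul0mx !mulmx0 !addr0 !add0r mulmx1 householder_sqr -scalar_mx_block.
have M1T : M1^T = M1.
  by rewrite tr_block_mx trmx1 !trmx0 householder_tr.
have GT s : (G s)^T = G (- s) by exact: givens_tr.
have GG : G rho *m G (- rho) = 1%:M by exact: givensK.
have GG' : G (- rho) *m G rho = 1%:M by exact: mulmx1C.
pose Q := G (- rho) *m (M1 *m O).
have -> : O = M1 *m (G rho *m Q).
  by rewrite /Q [G rho *m _]mulmxA GG mul1mx mulmxA M1M1 mul1mx.
apply: gaussian_invariantM => //; apply: gaussian_invariantM => //.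
have QQ : Q^T *m Q = 1%:M.
  rewrite /Q !trmx_mul GT opprK M1T -!mulmxA [G rho *m _]mulmxA GG mul1mx.
  by rewrite [M1 *m (M1 *m _)]mulmxA M1M1 mul1mx.
apply: base => //.
have Mc : M1 *m c = col_mx (usubmx c) (rho *: delta_mx 0 0).
  by rewrite -[c in LHS]vsubmxK mul_block_col mul1mx !mul0mx add0r addr0 H'c.
have Qe : Q *m (delta_mx 0 0 : 'cV[R]_(1 + n.+1)) = delta_mx 0 0.
  rewrite /Q -!mulmxA (_ : O *m _ = c); last first.
    rewrite -colE; apply/colP => i; rewrite !mxE; congr (O _ _); exact: val_inj.
  rewrite Mc; apply: givens_mul => // i.
  case: (fintype.split_ordP (i : 'I_(1 + n.+1))) => l ->.
    apply: etrans (@col_mxEu R 1 n.+1 1 _ _ l 0) _.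
    by rewrite !ord1 mxE /= addr0; congr (c _ _); exact: val_inj.
  apply: etrans (@col_mxEd R 1 n.+1 1 _ _ l 0) _.
  by rewrite !mxE /= add0r eqxx andbT mulr_natr.
apply/matrixP => i j; have /colP/(_ (rshift 1 i)) := Qe.
rewrite -colE [LHS]mxE [RHS]mxE /= => Q0; rewrite [RHS]mxE; apply: etrans _ Q0; rewrite /dlsubmx.
rewrite [LHS]mxE [LHS]mxE !ord1; congr (Q _ _); exact: val_inj.
Qed.

(** Induction on the columns, which are independent Gaussian vectors. The transposes in [f] are
    there because [std_gaussian_map] splits along rows. *)
Lemma std_gaussian_mull d (T : measurableType d) (P : probability T R) k m
    (O : 'M[R]_k) (X : T -> 'M[R]_(k, m)) :
  O^T *m O = 1%:M -> std_gaussian P X -> std_gaussian P (fun w => O *m X w).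
Proof.
move=> OO; elim: m X => [|m IH] X sX.
  congr (std_gaussian P _): sX; apply/funext => w.
  by rewrite [RHS]thinmx0 [LHS]thinmx0.
pose f l (x : 'M[R]_(l, k)) := (O *m x^T)^T.
have mf l : borel_map (@f l).
  move=> d' T' Y mY; apply: mx_measurable_tr; apply: borel_mulmx.
  exact: mx_measurable_tr.
have sXt : std_gaussian P (fun w => (X w : 'M[R]_(k, 1 + m))^T).
  exact: std_gaussian_tr.
have := std_gaussian_map sXt (mf 1%N) (mf m).
rewrite /f; under [X in std_gaussian P X -> _]funext do rewrite trmx_usub trmxK.
under [X in _ -> std_gaussian P X -> _]funext do rewrite trmx_dsub trmxK.
move=> /(_ _ _)/std_gaussian_tr H.
have := H (std_gaussian_tr (gaussian_invariant_orth OO (@std_gaussian_lsub _ _ _ _ 1 m _ _ sX)))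
  (std_gaussian_tr (IH _ (@std_gaussian_rsub _ _ _ _ 1 m _ _ sX))).
congr (std_gaussian P _); apply/funext => w.
rewrite tr_col_mx !trmxK trmx_usub trmx_dsub !trmxK.
by rewrite -mul_mx_row hsubmxK.
Qed.

Lemma std_gaussian_mulr d (T : measurableType d) (P : probability T R) k m
    (O : 'M[R]_m) (X : T -> 'M[R]_(k, m)) :
  O^T *m O = 1%:M -> std_gaussian P X -> std_gaussian P (fun w => X w *m O).
Proof.
move=> OO sX.
have OO' : (O^T)^T *m O^T = 1%:M by rewrite trmxK; exact: mulmx1C.
have := std_gaussian_tr (std_gaussian_mull OO' (std_gaussian_tr sX)).
by under [X in std_gaussian P X -> _]funext do rewrite trmx_mul !trmxK.
Qed.

End Rotation.

(** * Orthogonal projectors and the Moore-Penrose inverse *)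

Section OrthogonalProjector.
Context (R : realType).
Implicit Types (k m n : nat).

(* Q is the orthogonal projector onto the orthogonal complement of the row space of B. *)
Definition is_oproj k n (B : 'M[R]_(k, n)) (Q : 'M[R]_n) : Prop :=
  [/\ Q^T = Q, Q *m Q = Q, B *m Q = 0 & exists Y, Q = 1%:M - Y *m B].

(** The row space of B' lies in that of B, so the range of Q is contained in that of Q'. Uniqueness
    and monotonicity of the projector both follow from this. *)
Lemma oproj_sub k k' n (B : 'M[R]_(k, n)) (B' : 'M[R]_(k', n)) Z Q Q' :
  is_oproj B Q -> is_oproj B' Q' -> B' = Z *m B -> Q *m Q' = Q.
Proof.
move=> [Qt _ BQ _] [Qt' _ _ [Y' E']] BB'.
have QB : Q *m B^T = 0 by rewrite -Qt -trmx_mul BQ trmx0.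
rewrite -Qt' E' BB' linearB /= trmx1 !trmx_mul mulmxBr mulmx1 !mulmxA QB.
by rewrite !mul0mx subr0.
Qed.

Lemma oproj_unique k n (B : 'M[R]_(k, n)) Q Q' :
  is_oproj B Q -> is_oproj B Q' -> Q = Q'.
Proof.
move=> pQ pQ'.
have e1 := oproj_sub pQ pQ' (esym (mul1mx B)).
have e2 := oproj_sub pQ' pQ (esym (mul1mx B)).
have [Qt _ _ _] := pQ; have [Qt' _ _ _] := pQ'.
by rewrite -Qt -e1 trmx_mul Qt Qt' e2.
Qed.

Lemma oproj_dot k n (B : 'M[R]_(k, n)) Q x y : is_oproj B Q ->
  dot (Q *m x) (Q *m y) = dot x (Q *m y).
Proof. by move=> [Qt QQ _ _]; rewrite dot_mull Qt mulmxA QQ. Qed.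

Lemma oproj_le k n (B : 'M[R]_(k, n)) Q x : is_oproj B Q ->
  dot (Q *m x) (Q *m x) <= dot x x.
Proof.
move=> pQ; rewrite -subr_ge0.
have := dot_ge0 (x - Q *m x).
by rewrite !dotBl !dotBr (dotC _ x) (oproj_dot _ _ pQ) subrr subr0.
Qed.

Lemma oproj_mono k k' n (B : 'M[R]_(k, n)) (B' : 'M[R]_(k', n)) Z Q Q' x :
  is_oproj B Q -> is_oproj B' Q' -> B' = Z *m B ->
  dot (Q *m x) (Q *m x) <= dot (Q' *m x) (Q' *m x).
Proof.
move=> pQ pQ' BB'; rewrite -[in leLHS](oproj_sub pQ pQ' BB') -mulmxA.
exact: oproj_le pQ.
Qed.

(* One Gram-Schmidt step per row; a zero residual q is harmless since 1 / 0 = 0. *)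
Fixpoint oproj k n : 'M[R]_(k, n) -> 'M[R]_n :=
  match k with
  | 0 => fun _ => 1%:M
  | k'.+1 => fun B =>
      let Q := oproj (dsubmx (B : 'M[R]_(1 + k', n))) in
      let q := Q *m (usubmx (B : 'M[R]_(1 + k', n)))^T in
      Q - (dot q q)^-1 *: (q *m q^T)
  end.

Lemma oprojP k n (B : 'M[R]_(k, n)) : is_oproj B (oproj B).
Proof.
elim: k B => [|k IH] B.
  split; rewrite ?trmx1 ?mulmx1 //; first by rewrite flatmx0.
  by exists 0; rewrite mul0mx subr0.
change ('M[R]_(1 + k, n)) in (type of B).
rewrite -[B]vsubmxK; move: (usubmx B) (dsubmx B) => b {}B.
rewrite /= col_mxKu col_mxKd; have [Qt QQ BQ [Y QE]] := IH B.
set Q := oproj _ in Qt QQ BQ QE *; set q := Q *m b^T.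
set c := (dot q q)^-1.
change (is_oproj (col_mx b B) (Q - c *: (q *m q^T))).
have qt : q^T = b *m Q by rewrite trmx_mul trmxK Qt.
have Qq : Q *m q = q by rewrite mulmxA QQ.
have qQ : q^T *m Q = q^T by rewrite qt -mulmxA QQ.
have bq : b *m q = (dot q q)%:M.
  by rewrite -dot_scalar qt -mulmxA Qq.
have [q0|q0] := eqVneq (dot q q) 0.
  have q00 : q = 0 by apply/eqP; rewrite -dot_eq0 q0.
  rewrite q00 mul0mx scaler0 subr0; split => //.
    by rewrite mul_col_mx BQ -qt q00 trmx0 col_mx0.
  by exists (row_mx 0 Y); rewrite mul_row_col mul0mx add0r.
have cq : c * dot q q = 1 by rewrite mulVf.
split.
- by rewrite linearB /= linearZ /= trmx_mul trmxK Qt.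
- have QK : Q *m (q *m q^T) = q *m q^T by rewrite mulmxA Qq.
  have KQ : q *m q^T *m Q = q *m q^T by rewrite -mulmxA qQ.
  have KK : q *m q^T *m (q *m q^T) = dot q q *: (q *m q^T).
    by rewrite -mulmxA [q^T *m _]mulmxA dot_scalar mul_scalar_mx -scalemxAr.
  rewrite mulmxBl !mulmxBr QQ -!scalemxAr -!scalemxAl QK KQ KK.
  by rewrite [_ *: (_ *: (dot q q *: _))]scalerA scalerA -mulrA cq mulr1 subrr subr0.
- have Bq : B *m q = 0 by rewrite mulmxA BQ mul0mx.
  rewrite mul_col_mx !mulmxBr BQ -!scalemxAr (mulmxA b q) (mulmxA B q) Bq.
  rewrite mul0mx scaler0 subr0.
  by rewrite bq mul_scalar_mx scalerA cq scale1r -qt subrr col_mx0.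
(* Since q^T = b - b Y B, the correction c q q^T is itself a combination of the rows b and B. *)
- exists (row_mx (c *: q) (Y - c *: (q *m b *m Y))).
  have bQ : b *m Q = b - b *m Y *m B by rewrite QE mulmxBr mulmx1 mulmxA.
  have -> : q *m q^T = q *m b - q *m b *m Y *m B.
    by rewrite qt bQ mulmxBr (mulmxA q _ B) (mulmxA q b Y).
  rewrite mul_row_col mulmxBl -!scalemxAl scalerBr [in LHS]QE.
  by rewrite opprB !opprD opprK !addrA; rewrite -!addrA; congr (_ + _); rewrite addrA addrC addrA.
Qed.

Lemma mx_measurable_oproj d (T : measurableType d) k n (B : T -> 'M[R]_(k, n)) :
  mx_measurable B -> mx_measurable (fun w => oproj (B w)).
Proof.
elim: k B => [|k IH] B mB; first exact: mx_measurable_cst.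
have mQ := IH _ (@mx_measurable_dsub _ _ _ 1 k n _ mB).
have mq : mx_measurable (fun w => oproj (dsubmx (B w : 'M[R]_(1 + k, n))) *m
    (usubmx (B w : 'M[R]_(1 + k, n)))^T).
  apply: mx_measurableM => //; apply: mx_measurable_tr.
  exact: (@mx_measurable_usub _ _ _ 1 k n _ mB).
apply: mx_measurableB => //; apply: mx_measurableZ; last first.
  by apply: mx_measurableM => //; exact: mx_measurable_tr.
(* Inversion agrees with the measurable real power -1 on nonnegative numbers, 0 included. *)
under eq_fun do rewrite -powR_inv1 ?dot_ge0//.
apply: (measurableT_comp (@measurable_powR R (-1))).
exact: (mx_measurableM (mx_measurable_tr mq) mq).
Qed.

(* The squared distance from v to the row space of B. *)
Definition residual k n (B : 'M[R]_(k, n)) (v : 'cV[R]_n) : R :=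
  dot (oproj B *m v) (oproj B *m v).

Lemma residual_ge0 k n (B : 'M[R]_(k, n)) v : 0 <= residual B v.
Proof. exact: dot_ge0. Qed.

Lemma residual_le k n (B : 'M[R]_(k, n)) v : residual B v <= dot v v.
Proof. exact: oproj_le (oprojP B). Qed.

Lemma residual_mono k k' n (B : 'M[R]_(k, n)) (Z : 'M[R]_(k', k)) v :
  residual B v <= residual (Z *m B) v.
Proof. exact: oproj_mono (oprojP B) (oprojP _) erefl. Qed.

(** Subtracting an element of the row space of B leaves the distance unchanged, and keeping only the
    combinations Z B can only increase it. An explicit Kaczmarz step thus bounds the exact
    projection. *)
Lemma residual_shift k k' n (B : 'M[R]_(k, n)) (Z : 'M[R]_(k', k)) v y :
  residual B v <= residual (Z *m B) (v - B^T *m y).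
Proof.
apply: le_trans (residual_mono _ Z _); rewrite /residual.
have [Qt _ BQ _] := oprojP B.
suff -> : oproj B *m (v - B^T *m y) = oproj B *m v by [].
by rewrite mulmxBr mulmxA -[oproj B in X in _ - X]Qt -trmx_mul BQ trmx0 mul0mx subr0.
Qed.

Lemma residual_isometry k n (B : 'M[R]_(k, n)) (V : 'M[R]_n) v :
  V^T *m V = 1%:M -> residual (B *m V) v = residual B (V *m v).
Proof.
move=> VV; have VV' : V *m V^T = 1%:M by exact: mulmx1C.
have [Qt QQ BQ [Y QE]] := oprojP B.
rewrite /residual (_ : oproj (B *m V) = V^T *m oproj B *m V).
  by rewrite -!mulmxA dot_mull trmxK !mulmxA VV' mul1mx.
apply: oproj_unique (oprojP _) _; split.
- by rewrite !trmx_mul trmxK Qt mulmxA.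
- by rewrite -!mulmxA (mulmxA V) VV' mul1mx (mulmxA (oproj B) (oproj B)) QQ.
- by rewrite !mulmxA -(mulmxA B) VV' mulmx1 BQ mul0mx.
- exists (V^T *m Y); rewrite {1}QE mulmxBr mulmxBl mulmx1 VV.
  by rewrite !mulmxA.
Qed.

Lemma borel_residual k m n (M : 'M[R]_(m, n)) v :
  borel_fun (fun G : 'M[R]_(k, m) => (residual (G *m M) v)%:E).
Proof.
move=> d T X mX; apply/measurable_EFinP.
have mQ : mx_measurable (fun w => oproj (X w *m M) *m v).
  apply: mx_measurableM; last exact: mx_measurable_cst.
  apply: mx_measurable_oproj.
  exact: (mx_measurableM mX (@mx_measurable_cst _ _ _ _ _ M)).
exact: (mx_measurableM (mx_measurable_tr mQ) mQ).
Qed.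

(** Any G with B G B = B becomes a Moore-Penrose inverse X between the orthogonal projectors onto
    the row and column spaces: B X and X B are then those projectors, hence symmetric. *)
Lemma moore_penrose_exists m n (B : 'M[R]_(m, n)) : exists X, is_moore_penrose B X.
Proof.
have [Rt RR BR [Y RE]] := oprojP B.
have [Ct CC BC [Z CE]] := oprojP B^T.
pose Pr := 1%:M - oproj B; pose Pc := 1%:M - oproj B^T.
have Prt : Pr^T = Pr by rewrite linearB /= trmx1 Rt.
have Pct : Pc^T = Pc by rewrite linearB /= trmx1 Ct.
have PrE : Pr = Y *m B by rewrite /Pr RE opprB addrC subrK.
have PcE : Pc = B *m Z^T.
  by rewrite -Pct /Pc CE opprB addrC subrK trmx_mul trmxK.
have BPr : B *m Pr = B by rewrite mulmxBr mulmx1 BR subr0.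
have PcB : Pc *m B = B.
  by rewrite -Pct -[B in LHS]trmxK -trmx_mul mulmxBr mulmx1 BC subr0 trmxK.
have PrPr : Pr *m Pr = Pr by rewrite {1}PrE -mulmxA BPr -PrE.
pose G := pinvmx B.
have BGB : B *m G *m B = B by rewrite mulmxKpV.
pose X := Pr *m G *m Pc.
have BX : B *m X = Pc.
  by rewrite /X (mulmxA B (Pr *m G)) (mulmxA B Pr) BPr PcE (mulmxA _ B) BGB.
have XB : X *m B = Pr.
  by rewrite /X -(mulmxA _ Pc) PcB PrE -(mulmxA Y B) -(mulmxA Y) BGB.
exists X; split; rewrite ?BX ?XB //.
by rewrite /X (mulmxA Pr (Pr *m G)) (mulmxA Pr Pr) PrPr.
Qed.

(** Existence excludes the default value of [xget]; then 1 - X B has the properties that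
    characterize the projector. *)
Lemma moore_penrose_oproj m n (B : 'M[R]_(m, n)) (v : 'cV[R]_n) :
  v - moore_penrose B *m (B *m v) = oproj B *m v.
Proof.
have [BXB XBX BXt XBt] : is_moore_penrose B (moore_penrose B).
  have [X0 pX0] := moore_penrose_exists B.
  exact: (xgetPex 0 (ex_intro [set X | is_moore_penrose B X] X0 pX0)).
rewrite mulmxA -[v in v - _]mul1mx -mulmxBl; congr (_ *m v).
apply: oproj_unique _ (oprojP B); set X := moore_penrose B in BXB XBX BXt XBt *.
split.
- by rewrite linearB /= trmx1 XBt.
- by rewrite mulmxBl mul1mx mulmxBr mulmx1 -mulmxA (mulmxA B) BXB subrr subr0.
- by rewrite mulmxBr mulmx1 mulmxA BXB subrr.
- by exists X.
Qed.

End OrthogonalProjector.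

(** * A Kaczmarz step with a Gaussian row *)

Section Moments.
Context (R : realType).
Notation gauss := (@normal_prob R 0 1).
Notation mu := (@lebesgue_measure R).

Definition moment (j : nat) : \bar R := (\int[gauss]_x (x ^+ j)%:E)%E.

Lemma momentE j : (forall x : R, 0 <= x ^+ j) ->
  moment j = (\int[mu]_x ((x ^+ j)%:E * (normal_pdf 0 1 x)%:E))%E.
Proof.
move=> h; rewrite /moment integral_normal_prob01 //.
by apply/measurable_EFinP; apply: measurable_funX.
Qed.

Lemma moment_even_gt0 j : (0 < moment (2 * j))%E.
Proof.
have e0 (x : R) : 0 <= x ^+ (2 * j) by rewrite exprM exprn_ge0 ?sqr_ge0.
rewrite momentE //.
(* On [1, 2] the density is at least its value at 2, and the even power is at least 1. *)
pose p := normal_pdf 0 1 (2 : R).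
have p0 : 0 < p by rewrite /p normal_pdf01E mulr_gt0 ?expR_gt0 ?normal_peak_gt0.
apply: (@lt_le_trans _ _ (\int[mu]_x (p%:E * (\1_(`[1, 2]%classic : set R) x)%:E))%E).
  rewrite ge0_integralZl //=; last 2 first.
  - by apply: measurableT_comp => //; exact: measurable_indic.
  - by rewrite lee_fin ltW.
  rewrite integral_indic //= setIT lebesgue_measure_itv /= lte_fin.
  have -> : (1 : R) < 2 by lra.
  by rewrite -EFinB -EFinM lte_fin mulr_gt0 //; lra.
apply: ge0_le_integralW => x.
  by rewrite -EFinM lee_fin mulr_ge0 // ltW.
rewrite -!EFinM lee_fin indicE; case: (boolP (x \in _)); last first.
  by rewrite mulr0 mulr_ge0 ?normal_pdf_ge0.
rewrite inE /= in_itv /= => /andP[x1 x2]; rewrite mulr1.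
rewrite -[p]mul1r ler_pM //; first exact: ltW.
  by rewrite exprn_ege1.
rewrite /p !normal_pdf01E ler_wpM2l ?normal_peak_ge0// ler_expR.
by rewrite ler_pM2r ?invr_gt0 // lerN2 ler_sqr ?nnegrE //; lra.
Qed.

(** The integrand is dominated by a multiple of the N(0, 2) density: with y = x^2/4 the two
    exponentials are exp(-2y) and exp(-y), and 16 y^2 exp(-y) <= 64 because exp(y) >= (1 +
    y/2)^2. *)
Lemma moment4_fin : (moment 4 < +oo)%E.
Proof.
rewrite momentE; last by move=> x; rewrite (exprM x 2 2) sqr_ge0.
pose s : R := Num.sqrt 2.
have s2 : s ^+ 2 = 2 by rewrite sqr_sqrtr.
have s0 : s != 0 by rewrite gt_eqF // sqrtr_gt0.
pose K := normal_peak 1 / normal_peak s * 64.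
have ps0 : 0 < normal_peak s by exact: normal_peak_gt0.
have p10 : 0 < normal_peak (1 : R) by exact: (normal_peak_gt0 (oner_neq0 R)).
have K0 : 0 <= K by rewrite /K mulr_ge0 // mulr_ge0 ?invr_ge0 // ltW.
apply: (@le_lt_trans _ _ (\int[mu]_x (K%:E * (normal_pdf 0 s x)%:E))%E); last first.
  rewrite ge0_integralZl //=; last 2 first.
  - by apply: measurableT_comp => //; exact: measurable_normal_pdf.
  - by move=> x _; rewrite lee_fin normal_pdf_ge0.
  by rewrite integral_normal_pdf mule1 ltry.
apply: ge0_le_integralW => x.
  by rewrite -EFinM lee_fin mulr_ge0 ?normal_pdf_ge0 // (exprM x 2 2) sqr_ge0.
rewrite -!EFinM lee_fin normal_pdf01E normal_pdfE // /normal_fun subr0 s2.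
have -> : (2 : R) *+ 2 = 4 by ring.
set y := x ^+ 2 / 4.
have y0 : 0 <= y by rewrite /y divr_ge0 // sqr_ge0.
have -> : - x ^+ 2 / 4 = - y by rewrite mulNr.
have -> : - x ^+ 2 / 2 = - y + - y by rewrite /y; field.
have -> : x ^+ 4 = 16 * y ^+ 2 by rewrite /y; field.
rewrite expRD.
have -> : K * (normal_peak s * expR (- y)) = (normal_peak 1 * expR (- y)) * 64.
  by rewrite /K; field; rewrite gt_eqF.
have -> : 16 * y ^+ 2 * (normal_peak 1 * (expR (- y) * expR (- y))) =
   (normal_peak 1 * expR (- y)) * (16 * y ^+ 2 * expR (- y)) by ring.
apply: ler_wpM2l; first by rewrite mulr_ge0 ?expR_ge0 // ltW.
rewrite expRN ler_pdivrMr ?expR_gt0 //.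
have -> : expR y = expR (y / 2) ^+ 2 by rewrite expr2 -expRD -splitr.
have h : 1 + y / 2 <= expR (y / 2) by exact: expR_ge1Dx.
have h2 : (1 + y / 2) ^+ 2 <= expR (y / 2) ^+ 2.
  by rewrite ler_sqr ?nnegrE ?expR_ge0 //; lra.
apply: le_trans (_ : _ <= 64 * (1 + y / 2) ^+ 2) _; first by nra.
by rewrite ler_pM2l.
Qed.

Lemma gauss_moments : exists m2 m4 : R,
  [/\ 0 < m2, 0 < m4, m2 ^+ 2 <= m4, moment 2 = m2%:E & moment 4 = m4%:E].
Proof.
have le24 : (moment 2 <= 1 + moment 4)%E.
  have -> : (1 + moment 4 = \int[gauss]_x (1 + (x ^+ 4)%:E))%E.
    rewrite ge0_integralD //=; last 2 first.
    - by move=> x _; rewrite lee_fin (exprM x 2 2) sqr_ge0.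
    - by apply/measurable_EFinP; apply: measurable_funX.
    by rewrite integral_cst //= probability_setT mul1e.
  apply: ge0_le_integralW => x; first by rewrite lee_fin sqr_ge0.
  by rewrite -EFinD lee_fin; nra.
have p2 : (0 < moment 2)%E by exact: (moment_even_gt0 1).
have p4 : (0 < moment 4)%E by exact: (moment_even_gt0 2).
have f4 : moment 4 \is a fin_num by rewrite ge0_fin_numE ?moment4_fin // ltW.
have f2 : moment 2 \is a fin_num.
  rewrite ge0_fin_numE; last exact: ltW.
  by apply: le_lt_trans le24 _; rewrite lte_add_pinfty ?ltry ?moment4_fin.
exists (fine (moment 2)), (fine (moment 4)); rewrite !fineK //; split=> //.
- by rewrite fine_gt0 // p2 -ge0_fin_numE // ltW.
- by rewrite fine_gt0 // p4 moment4_fin.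
set m := fine (moment 2).
have m0 : 0 <= m by rewrite fine_ge0 // ltW.
have mx2 : measurable_fun setT (fun x : R => (x ^+ 2)%:E).
  by apply/measurable_EFinP; apply: measurable_funX.
have mx4 : measurable_fun setT (fun x : R => (x ^+ 4)%:E).
  by apply/measurable_EFinP; apply: measurable_funX.
(* Integrating 2 m x^2 <= x^4 + m^2 with m the second moment yields m2^2 <= m4. *)
have : ((2 * m)%:E * moment 2 <= moment 4 + (m ^+ 2)%:E)%E.
  have -> : ((2 * m)%:E * moment 2 = \int[gauss]_x ((2 * m)%:E * (x ^+ 2)%:E))%E.
    rewrite ge0_integralZl //=; first by move=> x _; rewrite lee_fin sqr_ge0.
    by rewrite lee_fin mulr_ge0.
  have -> : (moment 4 + (m ^+ 2)%:E = \int[gauss]_x ((x ^+ 4)%:E + (m ^+ 2)%:E))%E.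
    rewrite ge0_integralD //=.
    - by rewrite integral_cst //= probability_setT mule1.
    - by move=> x _; rewrite lee_fin (exprM x 2 2) sqr_ge0.
    - by move=> x _; rewrite lee_fin sqr_ge0.
  apply: ge0_le_integralW => x.
    by rewrite -EFinM lee_fin mulr_ge0 ?sqr_ge0 // mulr_ge0.
  rewrite -EFinM -EFinD lee_fin; have := sqr_ge0 (x ^+ 2 - m); nra.
by rewrite -(fineK f2) -(fineK f4) -/m -EFinM -EFinD lee_fin; nra.
Qed.

End Moments.

(** * Moments of linear forms in a Gaussian row *)

Section GaussianForms.
Context (R : realType).

Lemma measurable_form d (T : measurableType d) m (g : T -> 'rV[R]_m) (p : 'cV[R]_m) :
  mx_measurable g -> measurable_fun setT (fun w => (g w *m p) 0 0).
Proof. by move=> mg; apply: mx_measurableM => //; exact: mx_measurable_cst. Qed.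

(** A Householder reflection of g turns the form g p into |p| times the first entry of g, a scalar
    standard Gaussian. *)
Lemma integral_gaussian_form d (T : measurableType d) (P : probability T R) m
    (g : T -> 'rV[R]_m) (p : 'cV[R]_m) j :
  std_gaussian P g -> (0 < j)%N ->
  (\int[P]_w (((g w *m p) 0 0) ^+ (2 * j))%:E = (dot p p ^+ j)%:E * moment R (2 * j))%E.
Proof.
move=> sg j0; have e0 (x : R) : 0 <= x ^+ (2 * j) by rewrite exprM exprn_ge0 ?sqr_ge0.
case: m g p sg => [|m] g p sg.
  rewrite [p]flatmx0 dot0l expr0n gtn_eqF //= mul0e.
  under eq_integral do rewrite mulmx0 mxE expr0n muln_eq0 /= gtn_eqF //=.
  exact: integral0.
pose rho := Num.sqrt (dot p p).
have rho2 : rho ^+ 2 = dot p p by rewrite sqr_sqrtr // dot_ge0.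
pose H := householder p (rho *: delta_mx 0 0).
have Hp : H *m p = rho *: delta_mx 0 0.
  apply: householderE; rewrite dotZl dotZr dot_delta mxE !eqxx mulr1 -rho2.
  by rewrite expr2.
have sgH := std_gaussian_mulr (householder_orth p (rho *: delta_mx 0 0)) sg.
pose F (x : 'rV[R]_m.+1) := (((x *m p) 0 0) ^+ (2 * j))%:E.
have mF : borel_fun F.
  move=> d' T' Y mY; apply/measurable_EFinP; apply: measurable_funX.
  exact: measurable_form.
have F0 x : (0 <= F x)%E by rewrite lee_fin.
apply: etrans (std_gaussian_law sg sgH mF F0) _.
have -> : (\int[P]_w F (g w *m H) = \int[P]_w ((dot p p ^+ j)%:E * ((g w 0 0) ^+ (2 * j))%:E))%E.
  apply: eq_integral => w _; rewrite /F -mulmxA Hp -scalemxAr -colE !mxE.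
  by rewrite exprMn (exprM rho) rho2 EFinM.
have mg0 : measurable_fun setT (fun w => ((g w 0 0) ^+ (2 * j))%:E).
  by apply/measurable_EFinP; apply: measurable_funX; case: sg.
rewrite ge0_integralZl //=; last 2 first.
- by move=> w _; rewrite lee_fin.
- by rewrite lee_fin exprn_ge0 // dot_ge0.
congr (_ * _)%E.
have sl := @std_gaussian_lsub _ _ _ _ 1 m _ _ sg.
pose G (x : 'M[R]_1) := ((x 0 0) ^+ (2 * j))%:E.
have mG : borel_fun G.
  by move=> d' T' Y mY; apply/measurable_EFinP; apply: measurable_funX.
have := std_gaussian_law sl (std_gaussian_scalar R) mG (fun x => _).
rewrite /G => /(_ _) E; apply: etrans (etrans _ (E _)) _.
- by apply: eq_integral => w _; rewrite mxE; congr ((g w _ _ ^+ _)%:E); exact: val_inj.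
- by move=> x; rewrite lee_fin.
- by apply: eq_integral => x _; rewrite mxE eqxx.
Qed.

(** A weighted arithmetic-geometric mean inequality replaces the mixed moment of two correlated
    forms by their separate fourth moments. *)
Lemma integral_gaussian_form2 d (T : measurableType d) (P : probability T R) m
    (g : T -> 'rV[R]_m) (p q : 'cV[R]_m) (m4 : R) :
  std_gaussian P g -> moment R 4 = m4%:E -> 0 < m4 ->
  (\int[P]_w (((g w *m p) 0 0) ^+ 2 * ((g w *m q) 0 0) ^+ 2)%:E
     <= (m4 * dot p p * dot q q)%:E)%E.
Proof.
move=> sg m4E m40; have [mg _] := sg.
have z w : (g w *m (0 : 'cV[R]_m)) 0 0 = 0 by rewrite mulmx0 mxE.
have [p0|p0] := eqVneq p 0.
  rewrite p0 dot0l mulr0 mul0r.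
  under eq_integral do rewrite z expr0n /= mul0r.
  by rewrite integral0.
have [q0|q0] := eqVneq q 0.
  rewrite q0 dot0l mulr0.
  under eq_integral do rewrite z expr0n /= mulr0.
  by rewrite integral0.
have pp : 0 < dot p p by rewrite lt_def dot_eq0 p0 dot_ge0.
have qq : 0 < dot q q by rewrite lt_def dot_eq0 q0 dot_ge0.
(* Since a b = 1/4, x^2 y^2 <= a x^4 + b y^4; the ratio of the weights makes the two terms equal in
   expectation. *)
pose a := dot q q / dot p p / 2; pose b := dot p p / dot q q / 2.
have a0 : 0 < a by rewrite !divr_gt0.
have b0 : 0 < b by rewrite !divr_gt0.
have ab : a * b = 1 / 4 by rewrite /a /b; field; rewrite !gt_eqF.
pose f (u : 'cV[R]_m) w := (((g w *m u) 0 0) ^+ 4)%:E.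
have mf u : measurable_fun setT (f u).
  by apply/measurable_EFinP; apply: measurable_funX; exact: measurable_form.
have f0 u w : (0 <= f u w)%E by rewrite lee_fin (exprM _ 2 2) sqr_ge0.
apply: (@le_trans _ _ (\int[P]_w (a%:E * f p w + b%:E * f q w))%E).
  apply: ge0_le_integralW => w; first by rewrite lee_fin mulr_ge0 ?sqr_ge0.
  rewrite /f -!EFinM -EFinD lee_fin.
  set x := (g w *m p) 0 0; set y := (g w *m q) 0 0.
  have := sqr_ge0 (2 * a * x ^+ 2 - y ^+ 2).
  have e : (2 * a * x ^+ 2 - y ^+ 2) ^+ 2 =
     (4 * a) * (a * x ^+ 4 - x ^+ 2 * y ^+ 2) + y ^+ 4 by ring.
  have e2 : (4 * a) * (a * x ^+ 4 + b * y ^+ 4 - x ^+ 2 * y ^+ 2) =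
     (4 * a) * (a * x ^+ 4 - x ^+ 2 * y ^+ 2) + 4 * (a * b) * y ^+ 4 by ring.
  rewrite e => h; suff : 0 <= (4 * a) * (a * x ^+ 4 + b * y ^+ 4 - x ^+ 2 * y ^+ 2).
    by rewrite pmulr_rge0; [rewrite subr_ge0 | apply: mulr_gt0].
  by rewrite e2 ab (_ : 4 * (1 / 4) * y ^+ 4 = y ^+ 4) //; field.
rewrite ge0_integralD //=; last 4 first.
- by move=> w _; rewrite mule_ge0 // lee_fin ltW.
- by apply: emeasurable_funM.
- by move=> w _; rewrite mule_ge0 // lee_fin ltW.
- by apply: emeasurable_funM.
rewrite !ge0_integralZl //=; try by rewrite lee_fin ltW.
have E u : (\int[P]_w f u w = (dot u u ^+ 2 * m4)%:E)%E.
  by rewrite EFinM -m4E; exact: (@integral_gaussian_form _ _ _ _ _ u 2 sg isT).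
rewrite !E -!EFinM -EFinD lee_fin /a /b le_eqVlt; apply/orP; left; apply/eqP.
by field; rewrite !gt_eqF.
Qed.

Lemma dot_tr_mul m n (A : 'M[R]_(m, n)) (x : 'rV[R]_m) (v : 'cV[R]_n) :
  dot (x *m A)^T v = (x *m (A *m v)) 0 0.
Proof. by rewrite /dot trmxK mulmxA. Qed.

(* Expected decrease of one randomized Kaczmarz step with the Gaussian row
   b = g A: the relaxation c is the minimizer of the quadratic upper bound
   - 2 c m2 |A v|^2 + c^2 m4 |A v|^2 |A|_F^2. *)
Lemma kaczmarz_step d (T : measurableType d) (P : probability T R) m n
    (g : T -> 'rV[R]_m) (A : 'M[R]_(m, n)) (v : 'cV[R]_n) (m2 m4 : R) :
  std_gaussian P g -> 0 < m2 -> 0 < m4 ->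
  moment R 2 = m2%:E -> moment R 4 = m4%:E ->
  0 < \tr (A^T *m A) -> forall c, c = m2 / (m4 * \tr (A^T *m A)) ->
  forall y, y = (fun w => v - (c * dot (g w *m A)^T v) *: (g w *m A)^T) ->
  (\int[P]_w (dot (y w) (y w))%:E <=
   (dot v v - m2 ^+ 2 / m4 * (dot (A *m v) (A *m v) / \tr (A^T *m A)))%:E)%E.
Proof.
move=> sg m20 m40 m2E m4E; set t := \tr _ => t0 c cE y yD; have [mg _] := sg.
pose p := A *m v.
pose X w := (g w *m p) 0 0.
have mX : measurable_fun setT X by exact: measurable_form.
(* |g A|^2 is the sum over the columns of the squared forms g q_l, which brings the quartic term
   under [integral_gaussian_form2]. *)
pose q l := col l A.
pose Yq l w := (g w *m q l) 0 0.
have mYq l : measurable_fun setT (Yq l) by exact: measurable_form.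
have tE : t = \sum_l dot (q l) (q l).
  rewrite /t /mxtrace; apply: eq_bigr => l _; rewrite mxE dotE.
  by apply: eq_bigr => i _; rewrite !mxE.
have yE w : dot (y w) (y w) + 2 * c * X w ^+ 2 =
    dot v v + c ^+ 2 * \sum_l X w ^+ 2 * Yq l w ^+ 2.
  rewrite yD !dot_tr_mul -/p -/(X w) -mulr_sumr.
  have -> : \sum_l Yq l w ^+ 2 = dot (g w *m A)^T (g w *m A)^T.
    rewrite dotE; apply: eq_bigr => l _; rewrite mxE -expr2; congr (_ ^+ 2).
    by rewrite /Yq !mxE; apply: eq_bigr => i _; rewrite !mxE.
  rewrite !dotBl !dotBr !dotZl !dotZr (dotC v) dot_tr_mul -/p -/(X w).
  by ring.
have c0 : 0 < c by rewrite cE divr_gt0 // mulr_gt0.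
have my : measurable_fun setT (fun w => dot (y w) (y w)).
  have -> : (fun w => dot (y w) (y w)) =
     (fun w => dot v v + c ^+ 2 * (\sum_l X w ^+ 2 * Yq l w ^+ 2) - 2 * c * X w ^+ 2).
    by apply/funext => w; rewrite -yE addrK.
  apply: measurable_funB; last by apply: measurable_funM => //; exact: measurable_funX.
  apply: measurable_funD => //; apply: measurable_funM => //.
  by apply: measurable_sum => l; apply: measurable_funM; exact: measurable_funX.
have IX : (\int[P]_w (X w ^+ 2)%:E = (dot p p * m2)%:E)%E.
  by rewrite EFinM -m2E; exact: (@integral_gaussian_form _ _ _ _ _ p 1 sg isT).
have IY : (\int[P]_w (\sum_l X w ^+ 2 * Yq l w ^+ 2)%:E <= (m4 * dot p p * t)%:E)%E.
  under eq_integral do rewrite -sumEFin.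
  rewrite ge0_integral_sum //; last 2 first.
  - by move=> l; apply/measurable_EFinP; apply: measurable_funM; exact: measurable_funX.
  - by move=> l w _; rewrite lee_fin mulr_ge0 ?sqr_ge0.
  rewrite tE mulr_sumr -sumEFin; apply: lee_sum => l _.
  exact: integral_gaussian_form2.
(* The negative cross term is moved to the left, so that only nonnegative functions are
   integrated. *)
have Iadd : (\int[P]_w (dot (y w) (y w))%:E + (2 * c * (dot p p * m2))%:E <=
    (dot v v)%:E + (c ^+ 2 * (m4 * dot p p * t))%:E)%E.
  have -> : (2 * c * (dot p p * m2))%:E = (\int[P]_w (2 * c * X w ^+ 2)%:E)%E.
    rewrite EFinM -IX -ge0_integralZl //=.
    - by apply/measurable_EFinP; exact: measurable_funX.
    - by move=> w _; rewrite lee_fin sqr_ge0.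
    - by rewrite lee_fin mulr_ge0 // ltW.
  rewrite -ge0_integralD //=; last 4 first.
  - by move=> w _; rewrite lee_fin dot_ge0.
  - exact/measurable_EFinP.
  - by move=> w _; rewrite lee_fin mulr_ge0 ?sqr_ge0 // mulr_ge0 // ltW.
  - by apply/measurable_EFinP; apply: measurable_funM => //; exact: measurable_funX.
  under eq_integral do rewrite -EFinD yE EFinD EFinM.
  rewrite ge0_integralD //=; last 3 first.
  - by move=> w _; rewrite lee_fin dot_ge0.
  - move=> w _; rewrite -EFinM lee_fin mulr_ge0 ?sqr_ge0 // sumr_ge0 // => l _.
    by rewrite mulr_ge0 ?sqr_ge0.
  - apply: emeasurable_funM => //; apply/measurable_EFinP.
    by apply: measurable_sum => l; apply: measurable_funM; exact: measurable_funX.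
  rewrite integral_cst //= probability_setT mule1; apply: leeD2l.
  rewrite ge0_integralZl //=; last 3 first.
  - apply/measurable_EFinP.
    by apply: measurable_sum => l; apply: measurable_funM; exact: measurable_funX.
  - by move=> w _; rewrite lee_fin sumr_ge0 // => l _; rewrite mulr_ge0 ?sqr_ge0.
  - by rewrite lee_fin sqr_ge0.
  rewrite (EFinM (c ^+ 2) (m4 * _ * t)); apply: lee_wpmul2l => //.
  by rewrite lee_fin sqr_ge0.
have -> : dot v v - m2 ^+ 2 / m4 * (dot (A *m v) (A *m v) / t) =
   dot v v + c ^+ 2 * (m4 * dot p p * t) - 2 * c * (dot p p * m2).
  by rewrite -/p cE; field; rewrite !gt_eqF.
by rewrite EFinB EFinD leeBrDr.
Qed.

End GaussianForms.

(** * Expected residual of a Gaussian sketch *)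

Section ResidualBound.
Context (R : realType).

(** Quantifying over all probability spaces and all Gaussian matrices lets G be replaced by rotated
    copies or blocks of itself. *)
Definition residual_bound k m n (M : 'M[R]_(m, n)) (v : 'cV[R]_n) (beta : R) :=
  forall d (T : measurableType d) (P : probability T R) (G : T -> 'M[R]_(k, m)),
    std_gaussian P G -> (\int[P]_w (residual (G w *m M) v)%:E <= beta%:E)%E.

Lemma residual_bound_le k m n (M : 'M[R]_(m, n)) v beta beta' :
  beta <= beta' -> residual_bound k M v beta -> residual_bound k M v beta'.
Proof.
move=> bb' H d T P G sG; apply: le_trans (H _ _ _ _ sG) _.
by rewrite lee_fin.
Qed.

Lemma residual_bound_rot k m n (O : 'M[R]_m) (M : 'M[R]_(m, n)) v beta :
  O^T *m O = 1%:M -> residual_bound k (O *m M) v beta -> residual_bound k M v beta.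
Proof.
move=> OO H d T P G sG.
rewrite (std_gaussian_law sG (std_gaussian_mulr OO sG) (borel_residual M v)) //; last first.
  by move=> x; rewrite lee_fin residual_ge0.
under eq_integral do rewrite -mulmxA.
exact: H.
Qed.

(* The Householder reflection of the rows of G sends the first column of G to a
   multiple of the first basis vector; dropping the first row then removes the
   influence of the first row of the matrix M. *)
Lemma residual_bound_kill_row k m n (r : 'rV[R]_n) (B : 'M[R]_(m, n)) v beta :
  residual_bound k (col_mx 0 B : 'M[R]_(1 + m, n)) v beta ->
  residual_bound k.+1 (col_mx r B : 'M[R]_(1 + m, n)) v beta.
Proof.
move=> H d T P G sG.
(* The reflection [Hm] depends on the first column only; once that column is split off, it is a
   constant matrix for the remaining Gaussian columns. *)
rewrite (@std_gaussian_split_row _ _ _ _ 1 m _ _ _ sG (borel_residual _ v)); last first.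
  by move=> x; rewrite lee_fin residual_ge0.
have inner w : (\int[P]_w' (residual (row_mx (lsubmx (G w : 'M[R]_(k.+1, 1 + m)))
   (rsubmx (G w' : 'M[R]_(k.+1, 1 + m))) *m col_mx r B) v)%:E <= beta%:E)%E.
  pose c := lsubmx (G w : 'M[R]_(k.+1, 1 + m)).
  pose b : 'cV[R]_(1 + k) := Num.sqrt (dot c c) *: delta_mx 0 0.
  pose Hm : 'M[R]_(1 + k) := householder (c : 'cV[R]_(1 + k)) b.
  have Hc : Hm *m (c : 'cV[R]_(1 + k)) = b.
    apply: householderE; rewrite dotZl dotZr dot_delta mxE !eqxx mulr1.
    by rewrite -expr2 sqr_sqrtr // dot_ge0.
  have sZ := @std_gaussian_dsub _ _ _ _ 1 k _ _
    (std_gaussian_mull (householder_orth (c : 'cV[R]_(1 + k)) b) sG).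
  apply: le_trans _ (H _ _ _ _ sZ).
  apply: ge0_le_integralW => w'; first by rewrite lee_fin residual_ge0.
  rewrite lee_fin -/Hm -/c; set G' := rsubmx _.
  apply: le_trans (residual_mono _ (dsubmx Hm : 'M[R]_(k, 1 + k)) v) _.
  rewrite le_eqVlt; apply/orP; left; apply/eqP; congr residual.
  have db : dsubmx b = 0 by apply/colP => i; rewrite !mxE /= mulr0.
  rewrite mul_row_col mulmxDr !mulmxA [dsubmx Hm *m c]mul_dsub_mx Hc db mul0mx add0r.
  rewrite -[dsubmx (Hm *m G w')]hsubmxK mul_row_col mulmx0 add0r; congr (_ *m _).
  rewrite mul_dsub_mx; apply/matrixP => i j; rewrite !mxE.
  by apply: eq_bigr => l _; rewrite !mxE.
apply: (@le_trans _ _ (\int[P]_w beta%:E)%E).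
  apply: ge0_le_integralW => // w; apply: integral_ge0 => w' _.
  by rewrite lee_fin residual_ge0.
by rewrite integral_cst //= probability_setT mule1.
Qed.

(** A reflection U carrying the unit vector l to the first basis vector turns M - l l^T M into U M
    with its first row replaced by 0, so one Gaussian row is spent on annihilating l. *)
Lemma residual_bound_kill k m n (l : 'cV[R]_m) (M : 'M[R]_(m, n)) v beta :
  dot l l = 1 -> residual_bound k (M - l *m (l^T *m M)) v beta ->
  residual_bound k.+1 M v beta.
Proof.
case: m l M => [|m] l M ll H.
  by move: ll; rewrite [l]flatmx0 dot0l => /esym/eqP; rewrite oner_eq0.
pose e : 'cV[R]_(1 + m) := delta_mx 0 0.
pose U : 'M[R]_(1 + m) := householder (l : 'cV[R]_(1 + m)) e.
have OO : U^T *m U = 1%:M by exact: householder_orth.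
have OK : U *m U = 1%:M by exact: householder_sqr.
have Ol : U *m (l : 'cV[R]_(1 + m)) = e.
  by apply: householderE; rewrite ll dot_delta mxE !eqxx.
have eO : (l : 'cV[R]_(1 + m))^T = e^T *m U.
  by rewrite -Ol trmx_mul householder_tr -mulmxA OK mulmx1.
apply: (residual_bound_rot OO).
rewrite -[U *m M]vsubmxK; apply: residual_bound_kill_row.
have -> : col_mx 0 (dsubmx (U *m (M : 'M[R]_(1 + m, n)))) = U *m (M - l *m (l^T *m M)).
  rewrite mulmxBr (mulmxA U l) Ol eO -(mulmxA e^T).
  set N := U *m _; rewrite -[X in _ = X - _]vsubmxK -[X in _ - _ *m (_ *m X)]vsubmxK.
  have -> : e = col_mx 1%:M 0.
    apply/colP => i; rewrite !mxE; case: fintype.splitP => j /= ij.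
      by rewrite !mxE (ord1 j) !eqxx andbT -val_eqE /= ij (ord1 j).
    by rewrite mxE andbT -val_eqE /= ij.
  rewrite tr_col_mx trmx1 trmx0 mul_row_col mul1mx mul0mx addr0.
  by rewrite mul_col_mx mul1mx mul0mx opp_col_mx add_col_mx subrr oppr0 addr0.
by apply: (residual_bound_rot OO); rewrite mulmxA OK mul1mx.
Qed.

(** The Kaczmarz step subtracts a multiple of the first row of G M, so its squared norm dominates
    the residual; the other s rows are discarded. *)
Lemma residual_bound_single s m n (M : 'M[R]_(m, n)) v (m2 m4 : R) :
  0 < m2 -> 0 < m4 -> moment R 2 = m2%:E -> moment R 4 = m4%:E ->
  0 < \tr (M^T *m M) ->
  residual_bound s.+1 M v
    (dot v v - m2 ^+ 2 / m4 * (dot (M *m v) (M *m v) / \tr (M^T *m M))).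
Proof.
move=> m20 m40 m2E m4E t0 d T P G sG.
have su := @std_gaussian_usub _ _ _ _ 1 s _ _ sG.
apply: le_trans _ (@kaczmarz_step _ _ _ _ _ _ _ M v _ _ su m20 m40 m2E m4E t0 _ erefl _ erefl).
apply: ge0_le_integralW => w; first by rewrite lee_fin residual_ge0.
rewrite lee_fin; set u := usubmx _; set a := _ * dot _ v.
(* A [Z] without rows leaves the squared norm of the shifted vector as the bound. *)
have := residual_shift (G w *m M) (0 : 'M[R]_(0, s.+1)) v
  (col_mx a%:M 0 : 'cV[R]_(1 + s)).
move=> /le_trans; apply; apply: le_trans (residual_le _ _) _.
have GE : G w *m M = col_mx (u *m M) (dsubmx (G w : 'M[R]_(1 + s, m)) *m M).
  by rewrite -mul_col_mx vsubmxK.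
have E : (col_mx (u *m M) (dsubmx (G w : 'M[R]_(1 + s, m)) *m M))^T *m
    col_mx a%:M 0 = a *: (u *m M)^T.
  by rewrite tr_col_mx mul_row_col mulmx0 addr0 mul_mx_scalar.
have -> : (G w *m M)^T *m (col_mx a%:M 0 : 'cV[R]_(1 + s)) = a *: (u *m M)^T => //.
by rewrite GE; exact: E.
Qed.

(** The rows are used one after another. The vector is kept in the form M^T z because the lower
    bound by kap is assumed only on the range of M^T; a Kaczmarz step stays in that range. *)
Lemma residual_bound_multi s m n (M : 'M[R]_(m, n)) (z : 'cV[R]_m) (kap m2 m4 : R) :
  0 < m2 -> 0 < m4 -> moment R 2 = m2%:E -> moment R 4 = m4%:E ->
  0 < \tr (M^T *m M) ->
  (forall x, kap * dot (M^T *m x) (M^T *m x) <= dot (M *m (M^T *m x)) (M *m (M^T *m x))) ->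
  0 <= 1 - m2 ^+ 2 / m4 * (kap / \tr (M^T *m M)) ->
  residual_bound s M (M^T *m z)
    ((1 - m2 ^+ 2 / m4 * (kap / \tr (M^T *m M))) ^+ s * dot (M^T *m z) (M^T *m z)).
Proof.
move=> m20 m40 m2E m4E t0 hk; set x := (X in 0 <= X) => x0.
elim: s z => [|s IH] z d T P G sG.
  apply: (@le_trans _ _ (\int[P]_w (dot (M^T *m z) (M^T *m z))%:E)%E).
    apply: ge0_le_integralW => w; first by rewrite lee_fin residual_ge0.
    by rewrite lee_fin residual_le.
  by rewrite integral_cst //= probability_setT mule1 mul1r.
set v := M^T *m z.
rewrite (@std_gaussian_split _ _ _ _ 1 s _ _ _ sG (borel_residual _ v)); last first.
  by move=> y; rewrite lee_fin residual_ge0.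
have su := @std_gaussian_usub _ _ _ _ 1 s _ _ sG.
have sd := @std_gaussian_dsub _ _ _ _ 1 s _ _ sG.
pose u w := usubmx (G w : 'M[R]_(1 + s, m)).
pose c := m2 / (m4 * \tr (M^T *m M)).
pose a w := c * dot (u w *m M)^T v.
pose y w := v - a w *: (u w *m M)^T.
have yE w : y w = M^T *m (z - a w *: (u w)^T).
  by rewrite /y trmx_mul mulmxBr scalemxAr.
have my : measurable_fun setT (fun w => (dot (y w) (y w))%:E).
  have mu : mx_measurable (fun w => (u w *m M)^T).
    apply: mx_measurable_tr; apply: mx_measurableM; last exact: mx_measurable_cst.
    by case: su.
  have mY : mx_measurable y.
    apply: mx_measurableB; first exact: mx_measurable_cst.
    apply: mx_measurableZ => //; apply: measurable_funM => //.
    by apply: (mx_measurableM (mx_measurable_tr mu)); exact: mx_measurable_cst.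
  by apply/measurable_EFinP; exact: (mx_measurableM (mx_measurable_tr mY) mY).
apply: (@le_trans _ _ (\int[P]_w ((x ^+ s)%:E * (dot (y w) (y w))%:E))%E).
  apply: ge0_le_integralW => w.
    by apply: integral_ge0 => w' _; rewrite lee_fin residual_ge0.
  rewrite -EFinM yE; apply: le_trans _ (IH _ _ _ _ _ sd).
  apply: ge0_le_integralW => w'; first by rewrite lee_fin residual_ge0.
  rewrite lee_fin -yE -/(u w); set D := dsubmx _.
  have := residual_shift (col_mx (u w) D *m M) (row_mx 0 1%:M : 'M[R]_(s, 1 + s)) v
    (col_mx (a w)%:M 0 : 'cV[R]_(1 + s)).
  rewrite mul_col_mx mul_row_col mul0mx mul1mx add0r.
  by rewrite tr_col_mx mul_row_col mulmx0 addr0 mul_mx_scalar.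
rewrite ge0_integralZl //=; last 2 first.
- by move=> w _; rewrite lee_fin dot_ge0.
- by rewrite lee_fin exprn_ge0.
rewrite exprSr -mulrA EFinM; apply: lee_wpmul2l; first by rewrite lee_fin exprn_ge0.
apply: le_trans (@kaczmarz_step _ _ _ _ _ _ _ M v _ _ su m20 m40 m2E m4E t0 _ erefl _ erefl) _.
rewrite lee_fin /x mulrBl mul1r lerD2l lerN2 -[leLHS]mulrA.
apply: ler_wpM2l; first by rewrite divr_ge0 ?sqr_ge0 // ltW.
rewrite mulrAC ler_pM2r ?invr_gt0 //; exact: hk.
Qed.

(* Reflecting G by an isometry of R^m that induces on R^n an isometry fixing b
   and negating a makes the cross terms average out (parallelogram law). *)
Lemma residual_bound_add k m n (M : 'M[R]_(m, n)) (O : 'M[R]_m) (V : 'M[R]_n) a b al be :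
  O^T *m O = 1%:M -> V^T *m V = 1%:M -> O *m M = M *m V ->
  V *m a = - a -> V *m b = b ->
  residual_bound k M a al -> residual_bound k M b be ->
  residual_bound k M (a + b) (al + be).
Proof.
move=> OO VV OM Va Vb Ha Hb d T P G sG; have [mG _] := sG.
pose f v w := (residual (G w *m M) v)%:E.
have mf v : measurable_fun setT (f v) by exact: borel_residual mG.
have f0 v w : (0 <= f v w)%E by rewrite lee_fin residual_ge0.
have flip : (\int[P]_w f (a + b)%R w = \int[P]_w f (b - a)%R w)%E.
  rewrite /f (std_gaussian_law sG (std_gaussian_mulr OO sG) (borel_residual M _)) //; last first.
    by move=> x; rewrite lee_fin residual_ge0.
  apply: eq_integral => w _; rewrite -mulmxA OM mulmxA residual_isometry //.
  by rewrite mulmxDr Va Vb addrC.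
have two : (\int[P]_w f (a + b)%R w + \int[P]_w f (a + b)%R w =
   (\int[P]_w f a w + \int[P]_w f b w) + (\int[P]_w f a w + \int[P]_w f b w))%E.
  have D g h : measurable_fun setT g -> measurable_fun setT h ->
      (forall w, 0 <= g w)%E -> (forall w, 0 <= h w)%E ->
      (\int[P]_w g w + \int[P]_w h w = \int[P]_w (g w + h w))%E.
    by move=> mg mh g0 h0; rewrite ge0_integralD.
  have fab0 w : (0 <= f a w + f b w)%E by rewrite adde_ge0.
  have mfab : measurable_fun setT (fun w => f a w + f b w)%E by exact: emeasurable_funD.
  rewrite [X in (_ + X)%E]flip D // D // D //.
  apply: eq_integral => w _; rewrite /f -!EFinD; congr _%:E.
  rewrite /residual mulmxDr mulmxBr !dotDl !dotDr !dotNl !dotNr.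
  by ring.
have I1 : (\int[P]_w f (a + b)%R w + \int[P]_w f (a + b)%R w <=
    (al + be)%R%:E + (al + be)%R%:E)%E.
  by rewrite two !EFinD; apply: leeD; apply: leeD; [exact: Ha|exact: Hb|exact: Ha|exact: Hb].
have fin : (\int[P]_w f (a + b)%R w)%E \is a fin_num.
  rewrite ge0_fin_numE; last by apply: integral_ge0.
  apply: (@le_lt_trans _ _ (\int[P]_w (dot (a + b)%R (a + b)%R)%:E)%E).
    by apply: ge0_le_integralW => // w; rewrite lee_fin residual_le.
  by rewrite integral_cst //= probability_setT mule1 ltry.
move: I1; rewrite -/(f _) -(fineK fin) -!EFinD !lee_fin; lra.
Qed.

Lemma residual_bound_scale k m n (M : 'M[R]_(m, n)) v c beta :
  residual_bound k M v beta -> residual_bound k M (c *: v) (c ^+ 2 * beta).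
Proof.
move=> H d T P G sG; have [mG _] := sG.
under eq_integral do rewrite /residual -scalemxAr dotZl dotZr mulrA -expr2 EFinM.
rewrite ge0_integralZl //=; last 3 first.
- exact: borel_residual mG.
- by move=> w _; rewrite lee_fin dot_ge0.
- by rewrite lee_fin sqr_ge0.
by rewrite (EFinM (c ^+ 2) beta); apply: lee_wpmul2l; [rewrite lee_fin sqr_ge0|exact: H].
Qed.

End ResidualBound.

(** * Singular values *)

Section Spectral.
Context (R : realType).

(** A complex root z of the characteristic polynomial exists, and z = q / N with N = |v|^2 real and
    nonzero and q = v S v^* real by symmetry, so z is real. *)
Lemma symmetric_eigenvalue n (S : 'M[R]_n) : (0 < n)%N -> S^T = S ->
  exists a, eigenvalue S a.
Proof.
move=> n0 St; pose f := real_complex R.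
have [z] := @eigenvalue_closed (complex R) n (map_mx f S) n0.
rewrite eigenvalue_root_char => rz; have := rz; rewrite -eigenvalue_root_char.
move=> /eigenvalueP[v vz v0].
pose vs : 'cV[complex R]_n := map_mx Num.conj v^T.
pose q := (v *m map_mx f S *m vs) 0 0.
pose N := (v *m vs) 0 0.
have Nreal : N \is Num.real.
  rewrite /N mxE; apply: rpred_sum => i _; rewrite !mxE.
  by rewrite -normCK realX // normr_real.
have N0 : N != 0.
  rewrite /N mxE psumr_eq0; last by move=> i _; rewrite !mxE mul_conjC_ge0.
  apply/negP => /allP H; move/eqP: v0; apply; apply/rowP => i.
  have := H i (mem_index_enum i).
  by rewrite /= !mxE mul_conjC_eq0 => /eqP.
have qz : q = z * N by rewrite /q vz -scalemxAl mxE.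
have qreal : q \is Num.real.
  rewrite CrealE; apply/eqP.
  transitivity ((map_mx Num.conj (v *m map_mx f S *m vs)) 0 0); first by rewrite mxE.
  rewrite !map_mxM /= -[RHS]/(((v *m map_mx f S *m vs)) 0 0).
  have -> : map_mx Num.conj vs = v^T by apply/matrixP => i j; rewrite !mxE conjCK.
  have -> : map_mx Num.conj (map_mx f S) = map_mx f S.
    by apply/matrixP => i j; rewrite !mxE; apply/CrealP; rewrite complex_real.
  have -> : map_mx Num.conj v = vs^T by apply/matrixP => i j; rewrite !mxE.
  have -> : vs^T *m map_mx f S *m v^T = (v *m map_mx f S *m vs)^T.
    have fSt : (map_mx f S)^T = map_mx f S.
      by apply/matrixP => i j; rewrite !mxE -[in RHS]St mxE.
    by rewrite !trmx_mul fSt mulmxA.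
  by rewrite mxE.
have zreal : z \is Num.real.
  by rewrite -[z](mulfK N0) -qz realM // realV.
have /complex_realP[a za] := zreal.
exists a; rewrite eigenvalue_root_char.
by move: rz; rewrite za -map_char_poly; rewrite fmorph_root.
Qed.

(** Deflation: conjugating by the reflection that carries the first basis vector to a unit
    eigenvector splits off a 1 x 1 block, and symmetry clears the rest of the first row. *)
Theorem symmetric_spectral n (S : 'M[R]_n) : S^T = S ->
  exists V : 'M[R]_n, V^T *m V = 1%:M /\ exists d : 'rV[R]_n, V^T *m S *m V = diag_mx d.
Proof.
elim: n S => [|n IH] S St.
  exists 1%:M; rewrite trmx1 mulmx1; split => //.
  by exists 0; apply/matrixP => -[].
have [a /eigenvalueP[u ua u0]] := symmetric_eigenvalue (ltn0Sn n) St.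
pose e : 'cV[R]_(1 + n) := delta_mx 0 0.
have uu : 0 < dot u^T u^T by rewrite lt_def dot_ge0 dot_eq0 trmx_eq0 u0.
pose x : 'cV[R]_(1 + n) := (Num.sqrt (dot u^T u^T))^-1 *: u^T.
have xx : dot x x = 1.
  rewrite dotZl dotZr mulrA -expr2 exprVn sqr_sqrtr ?dot_ge0 //.
  by rewrite mulVf // gt_eqF.
have Sx : (S : 'M[R]_(1 + n)) *m x = a *: x.
  rewrite /x -scalemxAr scalerA mulrC -scalerA; congr (_ *: _).
  by rewrite -[S in LHS]St -trmx_mul ua linearZ.
have ee : dot e e = dot x x by rewrite xx dot_delta mxE !eqxx.
pose H : 'M[R]_(1 + n) := householder e x.
have HH : H *m H = 1%:M by exact: householder_sqr.
have Ht : H^T = H by exact: householder_tr.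
have He : H *m e = x by exact: householderE.
pose S1 : 'M[R]_(1 + n) := H *m S *m H.
have S1t : S1^T = S1 by rewrite !trmx_mul Ht St mulmxA.
have S1e : S1 *m e = a *: e.
  by rewrite -!mulmxA He Sx -scalemxAr -He mulmxA HH mul1mx.
have lS1 : lsubmx S1 = a *: e.
  rewrite -S1e -colE; apply/colP => i; rewrite [LHS]mxE [RHS]mxE; congr (S1 _ _).
  exact: val_inj.
have ul : ulsubmx S1 = a%:M.
  have := congr1 usubmx lS1; rewrite /ulsubmx => E.
  have -> : lsubmx (usubmx S1) = usubmx (lsubmx S1) by apply/matrixP => i j; rewrite !mxE.
  rewrite lS1; apply/matrixP => i j; rewrite !mxE !ord1 !eqxx.
  by rewrite mulr1.
have dl : dlsubmx S1 = 0.
  rewrite /dlsubmx; have -> : lsubmx (dsubmx S1) = dsubmx (lsubmx S1).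
    by apply/matrixP => i j; rewrite !mxE.
  by rewrite lS1; apply/matrixP => i j; rewrite !mxE /= mulr0.
have ur : ursubmx S1 = 0.
  by rewrite -[ursubmx S1]trmxK trmx_ursub S1t dl trmx0.
have St' : (drsubmx S1)^T = drsubmx S1 by rewrite trmx_drsub S1t.
have [V' [VV' [d' dE]]] := IH _ St'.
pose V1 : 'M[R]_(1 + n) := block_mx 1%:M 0 0 V'.
have VV1 : V1^T *m V1 = 1%:M.
  rewrite /V1 tr_block_mx mulmx_block !trmx0 !trmx1 !mul0mx !mulmx0 !addr0 !add0r.
  by rewrite VV' mulmx1 [RHS]scalar_mx_block.
exists (H *m V1); split.
  by rewrite trmx_mul -mulmxA (mulmxA H^T) Ht HH mul1mx.
exists (row_mx a%:M d' : 'rV[R]_(1 + n)).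
have -> : (H *m V1)^T *m S *m (H *m V1) = V1^T *m S1 *m V1.
  by rewrite trmx_mul Ht /S1 !mulmxA.
rewrite -[S1]submxK ul dl ur /V1 tr_block_mx !mulmx_block !trmx0 !trmx1.
rewrite !(mul0mx, mulmx0, addr0, add0r, mulmx1, mul1mx) dE.
apply: etrans _ (esym (@diag_mx_row _ n 1 a%:M d')).
by congr (block_mx _ _ _ _); apply/matrixP => i j; rewrite !mxE !ord1 eqxx.
Qed.

Lemma prod_XsubC_perm (F : fieldType) (s t : seq F) :
  \prod_(x <- s) ('X - x%:P) = \prod_(x <- t) ('X - x%:P) -> perm_eq s t.
Proof.
elim: s t => [|a s IH] t E.
  have := congr1 (fun p : {poly F} => size p) E.
  by rewrite big_nil size_poly1 size_prod_XsubC => -[] /esym/size0nil ->.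
have at_ : a \in t.
  by rewrite -root_prod_XsubC -E root_prod_XsubC mem_head.
have pt := perm_to_rem at_.
rewrite (perm_trans _ (_ : perm_eq (a :: rem a t) t)) ?(perm_sym _ t) // perm_cons.
apply: IH; move: E; rewrite (perm_big _ pt) !big_cons.
by apply: mulfI; rewrite polyXsubC_eq0.
Qed.

Lemma char_poly_conj n (V S : 'M[R]_n) : V^T *m V = 1%:M ->
  char_poly (V^T *m S *m V) = char_poly S.
Proof.
move=> VV; pose f (M : 'M[R]_n) := map_mx (@polyC R) M.
have fVV : f V^T *m f V = 1%:M by rewrite -map_mxM VV map_mx1.
rewrite /char_poly; have -> : char_poly_mx (V^T *m S *m V) = f V^T *m char_poly_mx S *m f V.
  rewrite /char_poly_mx mulmxBr mulmxBl -/f !map_mxM /=; congr (_ - _).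
  by rewrite scalar_mxC -mulmxA fVV mulmx1.
by rewrite !det_mulmx mulrAC -det_mulmx fVV det1 mul1r.
Qed.

Lemma perm_mx_orth n (p : {perm 'I_n}) : (perm_mx p : 'M[R]_n)^T *m perm_mx p = 1%:M.
Proof. by rewrite tr_perm_mx -perm_mxM mulVg perm_mx1. Qed.

(** Sorting the roots of the spectrum excludes the default value of [xget]. The characteristic
    polynomial fixes the squares up to order, and permuting the columns of V puts them in the order
    of [sigma]. *)
Theorem singular_value_basis m n (A : 'M[R]_(m, n)) :
  exists V : 'M[R]_n, [/\ V^T *m V = 1%:M,
    (A *m V)^T *m (A *m V) = diag_mx (\row_i sigma i.+1 A ^+ 2),
    sorted >=%R (singular_values A), size (singular_values A) = n
    & all (fun x => 0 <= x) (singular_values A)].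
Proof.
have St : (A^T *m A)^T = A^T *m A by rewrite trmx_mul trmxK.
have [V [VV [d dE]]] := symmetric_spectral St.
have d0 i : 0 <= d 0 i.
  have -> : d 0 i = (V^T *m (A^T *m A) *m V) i i by rewrite dE mxE eqxx.
  have -> : V^T *m (A^T *m A) *m V = (A *m V)^T *m (A *m V) by rewrite trmx_mul !mulmxA.
  by rewrite mxE sumr_ge0 // => l _; rewrite mxE -expr2 sqr_ge0.
have [s_sorted s_ge0 sE] : is_singular_values A (singular_values A).
  pose s0 := sort >=%R [seq Num.sqrt (d 0 i) | i <- enum 'I_n].
  suff h : is_singular_values A s0.
    exact: (xgetPex [::] (ex_intro [set s | is_singular_values A s] s0 h)).
  split.
  - by apply: sort_sorted => x y; exact: le_total.
  - by rewrite all_sort all_map; apply/allP => i _ /=; rewrite sqrtr_ge0.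
  - rewrite -(char_poly_conj _ VV) dE char_poly_trig ?diag_mx_is_trig //.
    rewrite (perm_big [seq Num.sqrt (d 0 i) | i <- enum 'I_n]) ?perm_sort //.
    rewrite big_map big_enum /=; apply: eq_bigr => i _.
    by rewrite mxE eqxx sqr_sqrtr.
set s := singular_values A in s_sorted s_ge0 sE *.
pose t : n.-tuple R := [tuple d 0 i | i < n].
have /tuple_permP[p pE] : perm_eq [seq x ^+ 2 | x <- s] t.
  apply: prod_XsubC_perm; rewrite big_map -sE -(char_poly_conj _ VV) dE.
  rewrite char_poly_trig ?diag_mx_is_trig // big_map big_enum /=.
  by apply: eq_bigr => i _; rewrite mxE eqxx.
have sn : size s = n by rewrite -(size_map (fun x => x ^+ 2)) pE size_map size_enum_ord.
have si (i : 'I_n) : s`_i ^+ 2 = d 0 (p i).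
  rewrite -(nth_map 0 0 (fun x => x ^+ 2)) ?sn // pE.
  by rewrite -tnth_nth !tnth_mktuple.
exists (V *m perm_mx p^-1); split => //.
  rewrite trmx_mul -mulmxA (mulmxA V^T) VV mul1mx; exact: perm_mx_orth.
have -> : (A *m (V *m perm_mx p^-1))^T *m (A *m (V *m perm_mx p^-1)) =
    perm_mx p *m diag_mx d *m perm_mx p^-1.
  rewrite -dE !trmx_mul tr_perm_mx invgK !mulmxA //.
rewrite -col_permE -row_permE; apply/matrixP => i j; rewrite !mxE (inj_eq perm_inj).
by rewrite /sigma -/s /= si.
Qed.

End Spectral.

(** * Contraction factor of one sketch *)

(** A reverse Bernoulli inequality at the cost of a factor 2: it turns s successive contractions
    into a gain linear in s. *)
Lemma bernoulli_upper (R : realFieldType) (x : R) s :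
  0 <= x -> s%:R * x <= 1 -> (1 - x) ^+ s <= 1 - s%:R * x / 2.
Proof.
move=> x0; elim: s => [|s IH] sx; first by rewrite expr0 !mul0r subr0.
have s0 : 0 <= s%:R :> R by [].
rewrite -natr1 in sx *.
have {}IH := IH _.
have sx' : s%:R * x <= 1 by nra.
have x1 : x <= 1 by nra.
rewrite exprSr; apply: le_trans (_ : (1 - s%:R * x / 2) * (1 - x) <= _).
  by rewrite ler_wpM2r ?subr_ge0 // IH.
nra.
Qed.

(** * Deletion of singular directions *)

Section DiagonalGram.
Context (R : realType).
Variables (m n : nat).
Implicit Types (M : 'M[R]_(m, n)) (d : 'rV[R]_n) (K : seq 'I_n).

Lemma diag_gram_dot M d y : M^T *m M = diag_mx d ->
  dot (M *m y) (M *m y) = \sum_i d 0 i * y i 0 ^+ 2.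
Proof.
move=> MM; rewrite dot_mull mulmxA MM dotC dotE; apply: eq_bigr => i _.
by rewrite mul_diag_mx mxE -mulrA -expr2.
Qed.

Lemma diag_gram_col M d i j : M^T *m M = diag_mx d ->
  dot (col i M) (col j M) = d 0 i *+ (i == j).
Proof.
move=> MM; transitivity ((M^T *m M) i j); last by rewrite MM mxE.
by rewrite dotE mxE; apply: eq_bigr => l _; rewrite !mxE.
Qed.

(** For M = A V in a right singular basis the columns are orthogonal, and zeroing some of them
    deletes their singular values. *)
Definition zero_cols K M : 'M[R]_(m, n) :=
  \matrix_(i, j) (if j \in K then 0 else M i j).

Lemma zero_cols_gram M d K : M^T *m M = diag_mx d ->
  (zero_cols K M)^T *m zero_cols K M =
  diag_mx (\row_i (if i \in K then 0 else d 0 i)).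
Proof.
move=> MM; apply/matrixP => i j.
have Mij : \sum_l M l i * M l j = d 0 i *+ (i == j).
  have /matrixP/(_ i j) := MM; rewrite !mxE => <-.
  by apply: eq_bigr => l _; rewrite mxE.
rewrite !mxE; have [iK|iK] := boolP (i \in K).
  by rewrite big1 ?mul0rn // => l _; rewrite !mxE iK mul0r.
rewrite -Mij; have [jK|jK] := boolP (j \in K).
  rewrite big1; last by move=> l _; rewrite !mxE jK mulr0.
  by rewrite Mij; case: eqP => // ij; rewrite -ij (negbTE iK) in jK.
by apply: eq_bigr => l _; rewrite !mxE (negbTE iK) (negbTE jK).
Qed.

(** l is the left singular vector of column j; as the columns are orthogonal, projecting it off
    affects that column alone. *)
Lemma zero_cols_cons M d j K : M^T *m M = diag_mx d -> 0 < d 0 j -> j \notin K ->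
  let l := (Num.sqrt (d 0 j))^-1 *: col j M in
  zero_cols (j :: K) M = zero_cols K M - l *m (l^T *m zero_cols K M).
Proof.
move=> MM dj jK l.
have lK : l^T *m zero_cols K M = Num.sqrt (d 0 j) *: delta_mx 0 j.
  apply/rowP => i; transitivity (dot l (col i (zero_cols K M))).
    by rewrite /dot !mxE; apply: eq_bigr => r _; rewrite !mxE.
  rewrite dotZl !mxE eqxx /=; have [->|ij] := eqVneq i j.
    rewrite (_ : col j (zero_cols K M) = col j M); last first.
      by apply/colP => r; rewrite !mxE (negbTE jK).
    rewrite (diag_gram_col _ _ MM) eqxx mulr1 -{2}(sqr_sqrtr (ltW dj)).
    by rewrite mulr1n expr2 mulrA mulVf ?mul1r // gt_eqF // sqrtr_gt0.
  rewrite mulr0; have [iK|iK] := boolP (i \in K).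
    rewrite (_ : col i _ = 0) ?dot0r ?mulr0 //.
    by apply/colP => r; rewrite !mxE iK.
  rewrite (_ : col i (zero_cols K M) = col i M); last first.
    by apply/colP => r; rewrite !mxE (negbTE iK).
  by rewrite (diag_gram_col _ _ MM) eq_sym (negbTE ij) mulr0n mulr0.
rewrite lK /l -scalemxAl -scalemxAr scalerA mulVf ?scale1r; last first.
  by rewrite gt_eqF // sqrtr_gt0.
apply/matrixP => r i; rewrite !mxE big_ord1 !mxE eqxx /= inE.
have [->|ij] /= := eqVneq i j; first by rewrite (negbTE jK) mulr1 subrr.
by rewrite mulr0 subr0.
Qed.

Lemma residual_bound_zero_cols k M d K v beta :
  M^T *m M = diag_mx d -> (forall i, 0 < d 0 i) -> uniq K ->
  residual_bound k (zero_cols K M) v beta -> residual_bound (size K + k) M v beta.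
Proof.
move=> MM d0; elim: K k => [|j K IH] k.
  move=> _; rewrite (_ : zero_cols [::] M = M) //.
  by apply/matrixP => i j; rewrite mxE.
move=> /= /andP[jK uK]; rewrite (zero_cols_cons MM (d0 j) jK) => H.
rewrite addSn -addnS; apply: IH => //; apply: residual_bound_kill H.
rewrite dotZl dotZr (diag_gram_col _ _ MM) eqxx mulrA -expr2 exprVn.
by rewrite sqr_sqrtr ?ltW // mulr1n mulVf // gt_eqF.
Qed.

(** Reflecting along the left singular vector of column j acts on M as the change of sign of
    coordinate j, which fixes the other basis vectors. So [residual_bound_add] peels off one
    coordinate at a time. *)
Lemma residual_bound_basis k M d x v :
  M^T *m M = diag_mx d -> (forall i, 0 < d 0 i) ->
  (forall i, residual_bound k M (delta_mx i 0) x) -> residual_bound k M v (x * dot v v).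
Proof.
move=> MM d0 H.
have vE : v = \sum_(i <- enum 'I_n) v i 0 *: delta_mx i 0.
  rewrite big_enum /= [LHS]matrix_sum_delta; apply: eq_bigr => i _.
  by rewrite big_ord1.
have vvE : dot v v = \sum_(i <- enum 'I_n) v i 0 ^+ 2.
  by rewrite big_enum dotE /=; apply: eq_bigr => i _; rewrite expr2.
rewrite [in X in residual_bound _ _ X]vE vvE.
elim: (enum 'I_n) (enum_uniq 'I_n) => [_|j r IH] /=.
  rewrite !big_nil mulr0 => e T P G sG.
  under eq_integral do rewrite /residual mulmx0 dot0l.
  by rewrite integral0.
move=> /andP[jr ur]; rewrite !big_cons mulrDr.
pose u := col j M; pose e : 'cV[R]_n := delta_mx j 0.
have uu : dot u u = d 0 j by rewrite (diag_gram_col _ _ MM) eqxx.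
have ee : dot e e = 1 by rewrite dot_delta mxE !eqxx.
have uM : u^T *m M = d 0 j *: e^T.
  apply/rowP => i; transitivity (dot u (col i M)).
    by rewrite /dot !mxE; apply: eq_bigr => l _; rewrite !mxE.
  rewrite (diag_gram_col _ _ MM) !mxE eqxx andbT (eq_sym i).
  by rewrite mulr_natr.
have refl p (w : 'cV[R]_p) : dot w w != 0 ->
    householder w (- w) = 1%:M - (2 / dot w w) *: (w *m w^T).
  move=> w0; have ww : w - - w = 2 *: w by rewrite opprK scaler_nat mulr2n.
  rewrite /householder ww dotZl dotZr.
  have -> : (2 *: w) *m (2 *: w)^T = (2 * 2) *: (w *m w^T).
    have -> : (2 *: w)^T = 2 *: w^T by rewrite linearZ.
    by rewrite -scalemxAl -scalemxAr scalerA.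
  by rewrite scalerA; congr (_ - _ *: _); field.
apply: (@residual_bound_add _ _ _ _ _ (householder u (- u)) (householder e (- e))).
- exact: householder_orth.
- exact: householder_orth.
- rewrite !refl ?uu ?ee ?oner_neq0 ?gt_eqF // mulmxBl mulmxBr mul1mx mulmx1.
  congr (_ - _); rewrite -scalemxAl -scalemxAr -mulmxA uM mulmxA.
  rewrite -scalemxAr scalerA divr1 divfK ?gt_eqF //; congr (_ *: (_ *m _)).
  by rewrite /u colE.
- rewrite -scalemxAr householderE ?scalerN // dotNl dotNr opprK //.
- have d0' : dot e (\sum_(i <- r) v i 0 *: delta_mx i 0) = 0.
    rewrite dot_delta summxE big_seq big1 // => i ir; rewrite !mxE.
    case: eqP => [ji|_] /=; last by rewrite mulr0.
    by rewrite ji ir in jr.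
  rewrite refl ?ee ?oner_neq0 // mulmxBl mul1mx -scalemxAl -mulmxA dot_scalar d0'.
  by rewrite raddf0 mulmx0 scaler0 subr0.
- by rewrite mulrC; apply: residual_bound_scale; exact: H.
- exact: IH.
Qed.

End DiagonalGram.

Section Contraction.
Context (R : realType).

(* Discarding the directions in K0 other than i leaves the trace tau or
   tau + d_i. If it is at most 2 tau all remaining rows contribute; otherwise
   d_i dominates and a single row already gives a constant gain. *)
Lemma residual_bound_unit m n (M : 'M[R]_(m, n)) (d : 'rV[R]_n) (K0 : seq 'I_n)
    (s0 : nat) (kap m2 m4 : R) (i : 'I_n) :
  0 < m2 -> 0 < m4 -> m2 ^+ 2 <= m4 -> moment R 2 = m2%:E -> moment R 4 = m4%:E ->
  M^T *m M = diag_mx d -> (forall i, 0 < d 0 i) -> uniq K0 ->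
  0 <= kap -> (forall i, kap <= d 0 i) -> (0 < s0)%N ->
  0 < \sum_(j | j \notin K0) d 0 j -> s0%:R * kap <= \sum_(j | j \notin K0) d 0 j ->
  residual_bound (size K0 + s0) M (delta_mx i 0)
    (1 - m2 ^+ 2 / m4 / 4 * (s0%:R * kap / \sum_(j | j \notin K0) d 0 j)).
Proof.
move=> m20 m40 m24 m2E m4E MM d0 uK kap0 kapd s00; set tau := \sum_(_ | _) _ => tau0 stau.
set rho := m2 ^+ 2 / m4.
have rho0 : 0 < rho by rewrite divr_gt0 // exprn_gt0.
have rho1 : rho <= 1 by rewrite ler_pdivrMr ?mul1r.
(* Zeroing column i itself would leave no decrease for the i-th basis vector. *)
pose K := [seq j <- K0 | j != i].
have iK : i \notin K by rewrite mem_filter /= eqxx.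
have uK' : uniq K by exact: filter_uniq.
have sK : (size K <= size K0)%N by rewrite size_filter count_size.
(* One more than s0 if i belonged to K0, since no row is then spent on i. *)
pose s := (size K0 - size K + s0)%N.
have -> : (size K0 + s0 = size K + s)%N by rewrite addnA subnKC.
apply: (residual_bound_zero_cols MM d0 uK').
set N := zero_cols K M.
pose d' : 'rV[R]_n := \row_i (if i \in K then 0 else d 0 i).
have NN : N^T *m N = diag_mx d' by exact: zero_cols_gram.
pose t := \tr (N^T *m N).
have tE : t = tau + (if i \in K0 then d 0 i else 0).
  rewrite /t NN mxtrace_diag; under eq_bigr do rewrite mxE mem_filter.
  rewrite (bigID (fun j => j \notin K0)) /=; congr (_ + _).
    by apply: eq_bigr => j jK; rewrite (negbTE jK) andbF.
  under eq_bigl do rewrite negbK.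
  case: ifPn => iK0; last first.
    rewrite big1 // => j jK; rewrite jK andbT; case: eqP => // ji.
    by rewrite -ji jK in iK0.
  rewrite (bigD1 i) //= eqxx /= big1 ?addr0 // => j /andP[jK ji].
  by rewrite ji jK.
have ttau : tau <= t by rewrite tE; case: ifP => _; rewrite ?addr0 // lerDl ltW.
have t0 : 0 < t by exact: lt_le_trans ttau.
(* This places the basis vector in the range of N^T, as [residual_bound_multi] requires. *)
pose z := (d 0 i)^-1 *: col i M.
have eE : delta_mx i 0 = N^T *m z.
  apply/colP => j; rewrite -scalemxAr !mxE eqxx andbT.
  have [jK|jK] := boolP (j \in K).
    rewrite big1 ?mulr0; last by move=> l _; rewrite !mxE jK mul0r.
    case: eqP => // ji; by rewrite -ji jK in iK.
  transitivity ((d 0 i)^-1 * dot (col j M) (col i M)).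
    rewrite (diag_gram_col _ _ MM); have [->|ji] := eqVneq j i.
      by rewrite mulr1n mulVf // gt_eqF.
    by rewrite mulr0n mulr0.
  by rewrite dotE; congr (_ * _); apply: eq_bigr => l _; rewrite !mxE (negbTE jK).
have ee : dot (delta_mx i 0 : 'cV[R]_n) (delta_mx i 0) = 1.
  by rewrite dot_delta mxE !eqxx.
have s0R : 1 <= s0%:R :> R by rewrite ler1n.
have [t2|t2] := leP t (2 * tau).
- pose x := rho * (kap / t).
  have kt0 : 0 <= kap / t by rewrite divr_ge0 // ltW.
  have x0 : 0 <= x by rewrite /x mulr_ge0 // ltW.
  have sx : s0%:R * x <= 1.
    rewrite /x mulrCA; apply: le_trans (_ : 1 * (s0%:R * (kap / t)) <= _).
      by rewrite ler_wpM2r // mulr_ge0.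
    by rewrite mul1r mulrA ler_pdivrMr // mul1r; apply: le_trans ttau.
  have x1 : x <= 1 by apply: le_trans sx; rewrite ler_peMl.
  (* Vectors in the range of N^T vanish on K, and off K every weight is at least kap. *)
  have hk y : kap * dot (N^T *m y) (N^T *m y) <= dot (N *m (N^T *m y)) (N *m (N^T *m y)).
    rewrite (diag_gram_dot _ NN) dotE mulr_sumr; apply: ler_sum => j _.
    rewrite -expr2 [d' 0 j]mxE; case: ifPn => jK; last by rewrite ler_wpM2r ?sqr_ge0.
    rewrite (_ : (N^T *m y) j 0 = 0) ?expr0n ?mulr0 //.
    by rewrite mxE big1 // => l _; rewrite !mxE jK mul0r.
  have x1' : 0 <= 1 - rho * (kap / t) by rewrite subr_ge0.
  have := residual_bound_multi (s := s) z m20 m40 m2E m4E t0 hk x1'.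
  rewrite -eE ee mulr1; apply: residual_bound_le.
  rewrite -/rho -/t -/x; apply: le_trans (_ : (1 - x) ^+ s0 <= _).
    rewrite ler_wiXn2l ?subr_ge0 ?leq_addl //.
    by rewrite lerBlDr lerDl.
  (* The denominator 4 is this 2 times the 2 of t <= 2 tau. *)
  apply: le_trans (bernoulli_upper x0 sx) _; rewrite lerD2l lerN2 /x.
  have -> : rho / 4 * (s0%:R * kap / tau) = rho * s0%:R * kap / 4 * tau^-1 by ring.
  have -> : s0%:R * (rho * (kap / t)) / 2 = rho * s0%:R * kap / 4 * (2 / t).
    by field; rewrite gt_eqF.
  apply: ler_wpM2l.
    apply: mulr_ge0 => //; apply: mulr_ge0 => //; apply: mulr_ge0 => //; exact: ltW.
  by rewrite -[2 / t]invf_div lef_pV2 ?posrE ?divr_gt0 // ler_pdivrMr // mulrC.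
- have iK0 : i \in K0.
    apply: contraLR t2 => iK0; rewrite -leNgt tE (negbTE iK0) addr0; lra.
  have di : t <= 2 * d 0 i by rewrite tE iK0 in t2 *; lra.
  have [s' sE] : exists s', s = s'.+1.
    by exists s.-1; rewrite prednK // /s addn_gt0 s00 orbT.
  rewrite sE.
  have := @residual_bound_single _ s' _ _ N (delta_mx i 0) _ _ m20 m40 m2E m4E t0.
  apply: residual_bound_le; rewrite ee lerD2l lerN2 -/rho -/t.
  have -> : dot (N *m (delta_mx i 0 : 'cV[R]_n)) (N *m delta_mx i 0) = d 0 i.
    rewrite -colE (diag_gram_col _ _ NN) eqxx mulr1n mxE (negbTE iK) //.
  rewrite -mulrA; apply: ler_wpM2l; first exact: ltW.
  (* The claimed gain is at most rho/4, since s0 kap <= tau, whereas d_i / t is at least 1/2. *)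
  apply: le_trans (_ : 4^-1 * 1 <= _).
    by rewrite ler_wpM2l // ler_pdivrMr ?mul1r.
  by rewrite ler_pdivlMr //; lra.
Qed.

(** [K0] holds the indices of the r largest singular values. The sum over the others has n - r >= k
    - r terms, each at least sigma_min^2, so the gain per basis vector is admissible. *)
Theorem gaussian_sketch_contraction : exists c0 : R, 0 < c0 /\
  forall (m n r k : nat) (A : 'M[R]_(m, n)), \rank A = n -> (r < k <= n)%N ->
  forall v : 'cV[R]_n, residual_bound k A v
    ((1 - c0 * ((k - r)%:R * sigma_min A ^+ 2 / \sum_(r <= j < n) sigma j.+1 A ^+ 2))
      * dot v v).
Proof.
have [m2 [m4 [m20 m40 m24 m2E m4E]]] := gauss_moments R.
exists (m2 ^+ 2 / m4 / 4); split; first by rewrite !divr_gt0 // exprn_gt0.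
move=> m n r k A rA /andP[rk kn] v.
have [V [VV MM ss sn s0]] := singular_value_basis A.
set M := A *m V in MM; set d := \row_i _ in MM.
suff H : residual_bound k M (V^T *m v) ((1 - m2 ^+ 2 / m4 / 4 *
   ((k - r)%:R * sigma_min A ^+ 2 / \sum_(r <= j < n) sigma j.+1 A ^+ 2))
      * dot (V^T *m v) (V^T *m v)).
  have VV' : V *m V^T = 1%:M by exact: mulmx1C.
  rewrite dot_isometry ?trmxK // in H.
  move=> e T P G sG; have := H _ _ _ _ sG.
  under eq_integral do rewrite mulmxA residual_isometry // mulmxA VV' mul1mx.
  by [].
have d0 i : 0 < d 0 i.
  have -> : d 0 i = dot (col i M) (col i M) by rewrite (diag_gram_col _ _ MM) eqxx.
  rewrite lt_def dot_ge0 dot_eq0 andbT; apply/eqP => Mi.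
  have fA : row_free A^T by rewrite /row_free mxrank_tr rA.
  have : (col i V)^T *m A^T = 0 *m A^T.
    by rewrite mul0mx -trmx_mul colE mulmxA -colE Mi trmx0.
  move=> /(row_free_inj fA)/(congr1 trmx); rewrite trmxK trmx0 colE => Vi.
  have : dot (delta_mx i 0 : 'cV[R]_n) (delta_mx i 0) = 0.
    by rewrite -(dot_isometry _ _ VV) Vi dot0l.
  by rewrite dot_delta mxE !eqxx => /eqP; rewrite oner_eq0.
have dE i : d 0 i = sigma i.+1 A ^+ 2 by rewrite mxE.
pose K0 := [seq i : 'I_n <- enum 'I_n | (i < r)%N].
have K0E i : (i \in K0) = (i < r)%N by rewrite mem_filter mem_enum andbT.
have uK0 : uniq K0 by rewrite filter_uniq // enum_uniq.
have rn : (r <= n)%N by exact: leq_trans (ltnW rk) kn.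
have sK0 : size K0 = r.
  rewrite -(size_map val) /K0 -(filter_map val (fun j => (j < r)%N)) val_enum_ord.
  by rewrite (@filter_iota_ltn 0 n r rn) size_iota.
have tauE : \sum_(j | j \notin K0) d 0 j = \sum_(r <= j < n) sigma j.+1 A ^+ 2.
  rewrite big_geq_mkord /=; apply: eq_big => [j|j _]; first by rewrite K0E -leqNgt.
  exact: dE.
have n0 : (0 < n)%N by apply: leq_trans kn; apply: leq_ltn_trans rk.
have n1 : (n.-1 < n)%N by rewrite ltn_predL.
pose last : 'I_n := Ordinal n1.
have minE : sigma_min A = sigma last.+1 A by rewrite /sigma_min /= prednK.
have kapd i : sigma_min A ^+ 2 <= d 0 i.
  have all_ge0 j : (j < n)%N -> 0 <= (singular_values A)`_j.
    by move=> jn; apply: (allP s0); rewrite mem_nth ?sn.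
  have a1 := all_ge0 _ n1; have a2 := all_ge0 _ (ltn_ord i).
  rewrite dE minE /sigma /= ler_sqr ?nnegrE //.
  have ge_tr : transitive (>=%R : rel R) by move=> x y z yx zy; exact: le_trans zy yx.
  have ge_refl : reflexive (>=%R : rel R) by move=> x; exact: lexx.
  have := sorted_leq_nth ge_tr ge_refl 0 ss; apply; rewrite ?inE ?sn //.
  by rewrite -ltnS prednK.
have kap0 : 0 < sigma_min A ^+ 2 by rewrite minE -(dE last).
have stau : (k - r)%:R * sigma_min A ^+ 2 <= \sum_(j | j \notin K0) d 0 j.
  rewrite tauE; apply: (@le_trans _ _ (\sum_(r <= j < n) sigma_min A ^+ 2)).
    rewrite sumr_const_nat -[leRHS]mulr_natl ler_wpM2r ?(ltW kap0) // ler_nat.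
    exact: leq_sub2r.
  rewrite big_nat [leRHS]big_nat; apply: ler_sum => j /andP[_ jn].
  by rewrite -(dE (Ordinal jn)).
have tau0 : 0 < \sum_(j | j \notin K0) d 0 j.
  by apply: lt_le_trans stau; rewrite mulr_gt0 // ltr0n subn_gt0.
apply: (@residual_bound_basis _ _ _ k M d _ _ MM d0) => i.
rewrite -tauE -{1}(subnKC (ltnW rk)) -{1}sK0.
apply: (residual_bound_unit i m20 m40 m24 m2E m4E MM d0 uK0) => //.
  exact: ltW.
by rewrite subn_gt0.
Qed.

End Contraction.

(** * Expected error of the iterates *)

Lemma sigma_algebra_forall T (G : set (set T)) (I : eqType) (r : seq I) (E : I -> set T) :
  (forall i, <<s G >> (E i)) -> <<s G >> [set w | forall i, i \in r -> E i w].
Proof.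
move=> GE.
have [GT _ _ GI] := (sigma_algebraP (U := setT) (C := <<s G >>) (fun X _ => @subsetT _ X)).1
  (smallest_sigma_algebra setT G).
elim: r => [|i r IH].
  by rewrite (_ : [set w | _] = setT) //; apply/seteqP; split.
rewrite (_ : [set w | _] = E i `&` [set w | forall i, i \in r -> E i w]).
  exact: GI.
apply/seteqP; split=> w /=.
  by move=> H; split=> [|j jr]; apply: H; rewrite inE ?eqxx // jr orbT.
by move=> [Ei H] j; rewrite inE => /orP[/eqP->//|]; exact: H.
Qed.

(** * The sequence of sketches as one Gaussian matrix *)

Section Stack.
Context (R : realType) d (T : measurableType d) (P : probability T R) (k m : nat).

Lemma independent_prod (I : choiceType) (F : I -> set (set T)) (r : seq I) (E : I -> set T) :
  independent P F -> uniq r -> (forall i, F i (E i)) ->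
  P [set w | forall i, i \in r -> E i w] = (\prod_(i <- r) P (E i))%E.
Proof.
move=> ind ur FE; pose J := [fset i in r]%fset.
have Jr : perm_eq J r.
  by apply: uniq_perm => // i; rewrite !inE.
rewrite -(perm_big _ Jr) -ind; last by move=> i _; exact: FE.
congr (P _); apply/seteqP; split => w /= H i.
  by move=> /= iJ; apply: H; move: iJ; rewrite !inE.
by move=> ir; apply: H => /=; rewrite !inE.
Qed.

Lemma gaussian_matrix_std (S : T -> 'M[R]_(k, m)) :
  gaussian_matrix P S -> std_gaussian P S.
Proof.
move=> [mS lS iS]; split=> // B mB.
rewrite (_ : _ @^-1` _ = [set w | forall p, p \in enum {: 'I_k * 'I_m} ->
    ((fun w => S w p.1 p.2) @^-1` B p.1 p.2) w]); last first.
  apply/seteqP; split=> w /= H; first by move=> p _; exact: H.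
  by move=> i j; apply: (H (i, j)); rewrite mem_enum.
rewrite (@independent_prod _ _ _ (fun p => (fun w => S w p.1 p.2) @^-1` B p.1 p.2)
  iS (enum_uniq _)); last first.
  by move=> p; exists (B p.1 p.2) => //; rewrite setTI.
rewrite big_enum /= pair_big; apply: eq_bigr => p _.
by rewrite -(lS p.1 p.2).
Qed.

(** With the newest sketch on top, the recursion matches that of [sketch_and_project], and
    independence of the past becomes a splitting of row blocks. *)
Fixpoint stack (S : nat -> 'M[R]_(k, m)) t : 'M[R]_(t * k, m) :=
  match t with
  | 0 => 0
  | t'.+1 => col_mx (S t') (stack S t')
  end.

Lemma std_gaussian_stack (S : nat -> T -> 'M[R]_(k, m)) t :
  independent_gaussian_matrices P S ->
  std_gaussian P (fun w => stack (S ^~ w) t).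
Proof.
move=> [gS iS]; have sS u := gaussian_matrix_std (gS u); split.
  elim: t => [|t IH] i j; first by case: i.
  have [mS _] := sS t.
  exact: (@mx_measurable_col _ _ _ k (t * k) m _ _ mS IH).
move=> B mB.
(* A box for the stack is an intersection over times of events of the single matrices; the induction
   only builds these events, and independence of the sequence is applied once. *)
suff [E [mE BE pE]] : exists E : nat -> set T, [/\ forall u, matrix_events (S u) (E u),
    (fun w => stack (S ^~ w) t) @^-1` box B = [set w | forall u, u \in iota 0 t -> E u w]
    & (\prod_(u <- iota 0 t) P (E u) = \prod_i \prod_j normal_prob 0 1 (B i j))%E].
  by rewrite BE (independent_prod iS (iota_uniq _ _)).
elim: t B mB => [|t IH] B mB.
  exists (fun=> setT); split.
  - move=> u; rewrite -(setD0 setT); apply: sigma_algebraCD; exact: sigma_algebra0.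
  - by apply/seteqP; split=> // w _ [].
  - by rewrite big_nil big_ord0.
pose Bu := usubmx (B : 'M[set R]_(k + t * k, m)).
pose Bd := dsubmx (B : 'M[set R]_(k + t * k, m)).
have mBu i j : measurable (Bu i j) by rewrite mxE.
have mBd i j : measurable (Bd i j) by rewrite mxE.
have [E [mE BE pE]] := IH Bd mBd.
have itE : iota 0 t.+1 = iota 0 t ++ [:: t] by rewrite -addn1 iotaD add0n.
exists (fun u => if u == t then S t @^-1` box Bu else E u); split.
- move=> u; case: eqP => [->|_ //].
  rewrite (_ : S t @^-1` box Bu = [set w | forall p, p \in enum {: 'I_k * 'I_m} ->
    ((fun w => S t w p.1 p.2) @^-1` Bu p.1 p.2) w]); last first.
    apply/seteqP; split=> w /= H; first by move=> p _; exact: H.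
    by move=> i j; apply: (H (i, j)); rewrite mem_enum.
  apply: sigma_algebra_forall => p; apply: sub_sigma_algebra.
  by exists p => //; exists (Bu p.1 p.2) => //; rewrite setTI.
- rewrite itE.
  apply/seteqP; split=> w /=.
    move=> /(@box_col_mx _ k (t * k) m (S t w) _ B)[Hu Hd] u.
    have : ((fun w => stack (S ^~ w) t) @^-1` box Bd) w by [].
    rewrite BE /= => HE; rewrite mem_cat inE => /orP[ut|/eqP ->]; last by rewrite eqxx.
    case: eqP => [utE|_]; last exact: HE.
    by rewrite utE mem_iota ltnn andbF in ut.
  move=> H; apply/(@box_col_mx _ k (t * k) m (S t w) _ B); split.
    by have := H t; rewrite eqxx; apply; rewrite mem_cat inE eqxx orbT.
  suff : ((fun w => stack (S ^~ w) t) @^-1` box Bd) w by [].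
  rewrite BE /= => u ut; have := H u; rewrite mem_cat ut /= => /(_ isT).
  by case: eqP => // utE; rewrite utE mem_iota ltnn andbF in ut.
- rewrite itE big_cat /= big_seq1 eqxx.
  rewrite (eq_big_seq (fun u => P (E u))); last first.
    move=> u; rewrite mem_iota /= => ut; case: eqP => // utE.
    by rewrite utE add0n ltnn in ut.
  rewrite pE [RHS](@big_split_ord _ _ _ k (t * k)) /= muleC; congr (_ * _)%E.
    have [_ ->] := sS t; last exact: mBu.
    by apply: eq_bigr => i _; apply: eq_bigr => j _; rewrite mxE.
  by apply: eq_bigr => i _; apply: eq_bigr => j _; rewrite mxE.
Qed.

End Stack.

Section Iterates.
Context (R : realType).

(** The inner integral runs over the upper block: the past is frozen while the newest sketch is
    averaged, as in a conditional expectation. *)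
Lemma std_gaussian_split_swap d (T : measurableType d) (P : probability T R) a b m
    (X : T -> 'M[R]_(a + b, m)) (F : 'M[R]_(a + b, m) -> \bar R) :
  std_gaussian P X -> borel_fun F -> (forall x, 0 <= F x)%E ->
  (\int[P]_w F (X w) =
   \int[P]_w' \int[P]_w F (col_mx (usubmx (X w)) (dsubmx (X w'))))%E.
Proof.
move=> sX mF F0.
have sZ := std_gaussian_prod (std_gaussian_usub sX) (std_gaussian_dsub sX).
rewrite (std_gaussian_law sX sZ mF F0).
rewrite (fubini_tonelli2 (fun z : T * T => F (col_mx (usubmx (X z.1)) (dsubmx (X z.2))))) //.
by apply: mF; case: sZ.
Qed.

Variables (k m n : nat) (A : 'M[R]_(m, n)) (e0 : 'cV[R]_n).

Fixpoint error t : 'M[R]_(t * k, m) -> 'cV[R]_n :=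
  match t with
  | 0 => fun _ => e0
  | t'.+1 => fun M => oproj (usubmx (M : 'M[R]_(k + t' * k, m)) *m A) *m
      error (dsubmx (M : 'M[R]_(k + t' * k, m)))
  end.

Lemma mx_measurable_error d (T : measurableType d) t (X : T -> 'M[R]_(t * k, m)) :
  mx_measurable X -> mx_measurable (fun w => error (X w)).
Proof.
elim: t X => [|t IH] X mX; first exact: mx_measurable_cst.
have mu := @mx_measurable_usub _ _ _ k (t * k) _ _ mX.
have md := @mx_measurable_dsub _ _ _ k (t * k) _ _ mX.
apply: mx_measurableM; last exact: IH.
apply: mx_measurable_oproj; apply: mx_measurableM => //.
Qed.

Lemma borel_error t : borel_fun (fun M => (dot (@error t M) (error M))%:E).
Proof.
move=> d T X mX; apply/measurable_EFinP; have mE := mx_measurable_error mX.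
exact: (mx_measurableM (mx_measurable_tr mE) mE).
Qed.

Lemma integral_error_le d (T : measurableType d) (P : probability T R) t
    (X : T -> 'M[R]_(t * k, m)) (x : R) :
  0 <= x -> (forall v, residual_bound k A v (x * dot v v)) -> std_gaussian P X ->
  (\int[P]_w (dot (error (X w)) (error (X w)))%:E <= (x ^+ t * dot e0 e0)%:E)%E.
Proof.
move=> x0 H; elim: t X => [|t IH] X sX.
  by rewrite /= integral_cst //= probability_setT mule1 mul1r.
rewrite (@std_gaussian_split_swap _ _ _ k (t * k) _ _ _ sX (@borel_error t.+1)); last first.
  by move=> y; rewrite lee_fin dot_ge0.
have su := @std_gaussian_usub _ _ _ _ k (t * k) _ _ sX.
have sd := @std_gaussian_dsub _ _ _ _ k (t * k) _ _ sX.
pose e w := error (dsubmx (X w : 'M[R]_(k + t * k, m))).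
apply: (@le_trans _ _ (\int[P]_w (x%:E * (dot (e w) (e w))%:E))%E).
  apply: ge0_le_integralW => w.
    by apply: integral_ge0 => w' _; rewrite lee_fin dot_ge0.
  rewrite -EFinM; apply: le_trans _ (H (e w) _ _ _ _ su).
  apply: ge0_le_integralW => w'; first by rewrite lee_fin dot_ge0.
  by rewrite /= col_mxKu col_mxKd.
rewrite ge0_integralZl //=; last 2 first.
- by apply: borel_error; case: sd.
- by move=> w _; rewrite lee_fin dot_ge0.
rewrite exprS -mulrA (EFinM x); apply: lee_wpmul2l; first by rewrite lee_fin.
exact: IH.
Qed.

Lemma norm2_sqr p (v : 'cV[R]_p) : norm2 v ^+ 2 = dot v v.
Proof.
rewrite sqr_sqrtr; last by apply: sumr_ge0 => i _; exact: sqr_ge0.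
by rewrite dotE; apply: eq_bigr => i _; rewrite expr2.
Qed.

Lemma sketch_and_project_error (b : 'cV[R]_m) (xs x0 : 'cV[R]_n) (S : nat -> 'M[R]_(k, m)) t :
  A *m xs = b -> e0 = x0 - xs ->
  sketch_and_project A b S x0 t - xs = error (stack S t).
Proof.
move=> Ab e0E; elim: t => [|t IH]; first by rewrite /= e0E.
rewrite /= (@col_mxKu _ k (t * k)) (@col_mxKd _ k (t * k)) -IH -Ab -mulmxBr (mulmxA (S t) A).
by rewrite -moore_penrose_oproj addrAC.
Qed.

End Iterates.

Lemma expected_error_le (R : realType) (k m n : nat) (A : 'M[R]_(m, n)) (x : R) :
  (0 < n)%N -> (forall v, residual_bound k A v (x * dot v v)) ->
  forall (d : measure_display) (T : measurableType d) (P : probability T R)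
    (S : nat -> T -> 'M[R]_(k, m)), independent_gaussian_matrices P S ->
  forall (b : 'cV[R]_m) (xstar : 'cV[R]_n), A *m xstar = b ->
  forall (x0 : 'cV[R]_n) (t : nat),
    ('E_P[(fun w => norm2 (sketch_and_project A b (S ^~ w) x0 t - xstar) ^+ 2)%R]
     <= (x ^+ t * norm2 (x0 - xstar) ^+ 2)%:E)%E.
Proof.
move=> n0 H d T P S iS b xs Ab x0 t; rewrite unlock norm2_sqr.
(* For a unit vector x bounds the expectation of a nonnegative residual, so the sign of the
   contraction factor comes for free in all three regimes. *)
have x_ge0 : 0 <= x.
  pose e : 'cV[R]_n := delta_mx (Ordinal n0) 0.
  have sS := gaussian_matrix_std (iS.1 0%N).
  have := H e _ _ _ _ sS; rewrite dot_delta mxE !eqxx mulr1 -lee_fin.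
  by apply: le_trans; apply: integral_ge0 => w _; rewrite lee_fin residual_ge0.
under eq_integral do
  rewrite norm2_sqr (sketch_and_project_error _ _ Ab erefl).
exact: integral_error_le (std_gaussian_stack t iS).
Qed.

(** * The three spectral regimes *)

Section Tails.
Context (R : realType).

(** Telescoping: alpha^-(j+1) = (alpha^-j - alpha^-(j+1)) / (alpha - 1). *)
Lemma geometric_tail (alpha : R) r n : 1 < alpha ->
  \sum_(r <= j < n) alpha ^- j.+1 <= alpha ^- r / (alpha - 1).
Proof.
move=> a1; have a0 : 0 < alpha by exact: lt_trans a1.
have am : 0 < alpha - 1 by rewrite subr_gt0.
have [nr|rn] := leqP n r.
  by rewrite big_geq // divr_ge0 ?invr_ge0 ?exprn_ge0 // ltW.
rewrite (eq_bigr (fun j => - (alpha ^- j.+1 / (alpha - 1)) - - (alpha ^- j / (alpha - 1)))).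
  rewrite telescope_sumr; last exact: ltnW.
  rewrite opprK addrC gerBl divr_ge0 ?invr_ge0 ?exprn_ge0 // ltW //.
move=> j _; rewrite exprS invfM; field.
by rewrite !gt_eqF // ?exprn_gt0.
Qed.

(** A discrete integral comparison. Divided by (j+1)^(1 - beta), it bounds u^(1 - beta) from below
    for u = j/(j+1), by ln u <= u - 1 and exp x >= 1 + x. *)
Lemma power_decrement (beta : R) j : 1 < beta -> (0 < j)%N ->
  (beta - 1) * j.+1%:R `^ (- beta) <= j%:R `^ (1 - beta) - j.+1%:R `^ (1 - beta).
Proof.
move=> b1 j0; have j0R : 0 < j%:R :> R by rewrite ltr0n.
have y0 : 0 < j.+1%:R :> R by rewrite ltr0n.
pose u : R := j%:R / j.+1%:R.
have u0 : 0 < u by rewrite divr_gt0.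
have jE : j%:R = j.+1%:R * u :> R by rewrite /u mulrC divfK // gt_eqF.
have yb : j.+1%:R `^ (- beta) = j.+1%:R `^ (1 - beta) / j.+1%:R :> R.
  by rewrite -powR_inv1 ?ltW // -powRD ?(gt_eqF y0) ?implybT //; congr (_ `^ _); ring.
have pu : 1 + (beta - 1) / j.+1%:R <= u `^ (1 - beta).
  rewrite /powR gt_eqF //; apply: le_trans (expR_ge1Dx _).
  rewrite lerD2l.
  have lnu : ln u <= u - 1.
    have := @le_ln1Dx R (u - 1); rewrite (_ : 1 + (u - 1) = u); last by ring.
    by apply; lra.
  have uE : u - 1 = - j.+1%:R^-1.
    rewrite /u -[X in X / _](addrK 1) -natr1 mulrDl divff ?gt_eqF //.
    by rewrite mulN1r addrAC subrr add0r.
  rewrite uE in lnu.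
  have -> : (1 - beta) * ln u = (beta - 1) * - ln u by ring.
  by apply: ler_wpM2l; [rewrite subr_ge0 ltW|rewrite lerNr].
rewrite jE powRM ?(ltW y0, ltW u0) // yb.
have yp : 0 <= j.+1%:R `^ (1 - beta) :> R by rewrite powR_ge0.
have -> : (beta - 1) * (j.+1%:R `^ (1 - beta) / j.+1%:R) =
   j.+1%:R `^ (1 - beta) * ((1 + (beta - 1) / j.+1%:R) - 1) :> R by ring.
have -> (y : R) : y * u `^ (1 - beta) - y = y * (u `^ (1 - beta) - 1) by ring.
by apply: ler_wpM2l => //; rewrite lerB.
Qed.

Lemma power_tail (beta : R) r n : 1 < beta ->
  \sum_(r <= j < n) j.+1%:R `^ (- beta) <=
    (1 + (beta - 1)^-1) * r.+1%:R `^ (1 - beta).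
Proof.
move=> b1; have bm : 0 < beta - 1 by rewrite subr_gt0.
have [nr|rn] := leqP n r.
  by rewrite big_geq // mulr_ge0 ?powR_ge0 // addr_ge0 // invr_ge0 ltW.
rewrite big_ltn // mulrDl mul1r lerD //.
  by rewrite ler_powR // ?ler1n //; lra.
apply: (@le_trans _ _ (\sum_(r.+1 <= j < n)
   (- (j.+1%:R `^ (1 - beta) / (beta - 1)) - - (j%:R `^ (1 - beta) / (beta - 1))))).
  rewrite big_nat [leRHS]big_nat; apply: ler_sum => j /andP[rj _].
  rewrite opprK addrC -mulrBl ler_pdivlMr // mulrC.
  by apply: power_decrement => //; exact: leq_trans rj.
rewrite telescope_sumr // opprK addrC mulrC gerBl.
by rewrite divr_ge0 ?powR_ge0 // ltW.
Qed.

End Tails.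

(** * From the tail of the spectrum to the rate *)

Section Rates.
Context (R : realType).

Lemma norm_frob_sigma m n (A : 'M[R]_(m, n)) :
  norm_frob A ^+ 2 = \sum_(0 <= j < n) sigma j.+1 A ^+ 2.
Proof.
have [V [VV MM _ _ _]] := singular_value_basis A.
rewrite sqr_sqrtr; last first.
  by apply: sumr_ge0 => i _; apply: sumr_ge0 => j _; exact: sqr_ge0.
transitivity (\tr (A^T *m A)).
  rewrite exchange_big /=; apply: eq_bigr => j _; rewrite mxE.
  by apply: eq_bigr => i _; rewrite mxE expr2.
have VV' : V *m V^T = 1%:M by exact: mulmx1C.
rewrite -[A^T *m A]mulmx1 -VV' mulmxA mxtrace_mulC.
have -> : V^T *m (A^T *m A *m V) = (A *m V)^T *m (A *m V) by rewrite trmx_mul !mulmxA.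
rewrite MM mxtrace_diag big_mkord; apply: eq_bigr => i _; by rewrite mxE.
Qed.

Lemma tail_rate_le m n r k (A : 'M[R]_(m, n)) (tau : R) :
  (r < k <= n)%N -> \sum_(r <= j < n) sigma j.+1 A ^+ 2 <= tau ->
  (k - r)%:R * sigma_min A ^+ 2 / tau <=
  (k - r)%:R * sigma_min A ^+ 2 / \sum_(r <= j < n) sigma j.+1 A ^+ 2.
Proof.
(* If sigma_min = 0 both sides vanish; otherwise the tail contains sigma_n^2 > 0 and the quotients
   can be compared. *)
move=> /andP[rk kn] tt; have [s0|s0] := eqVneq (sigma_min A ^+ 2) 0.
  by rewrite s0 mulr0 !mul0r.
have rn : (r < n)%N by exact: leq_trans kn.
apply: ler_wpM2l; first by rewrite mulr_ge0 ?sqr_ge0.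
have t0 : 0 < \sum_(r <= j < n) sigma j.+1 A ^+ 2.
  case: n A tt s0 kn rn => [//|n] A tt s0 kn rn.
  rewrite big_nat_recr //=.
  apply: ltr_wpDl; first by apply: sumr_ge0 => j _; exact: sqr_ge0.
  by rewrite lt_def sqr_ge0 andbT.
by rewrite lef_pV2 ?posrE //; exact: lt_le_trans tt.
Qed.

Lemma sigma1_le m n (A : 'M[R]_(m, n)) : (0 < n)%N -> sigma 1 A ^+ 2 <= norm_frob A ^+ 2.
Proof.
move=> n0; rewrite norm_frob_sigma big_ltn // lerDl.
by apply: sumr_ge0 => j _; exact: sqr_ge0.
Qed.

(** Common form of the three regimes: L bounds the tail relative to |A|_F^2, and [rate] is the gain
    that this leaves. *)
Lemma contraction_rate (c0 : R) m n r k (A : 'M[R]_(m, n)) (L rate : R) :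
  0 <= c0 -> (r < k <= n)%N ->
  (forall v, residual_bound k A v
    ((1 - c0 * ((k - r)%:R * sigma_min A ^+ 2 / \sum_(r <= j < n) sigma j.+1 A ^+ 2))
      * dot v v)) ->
  \sum_(r <= j < n) sigma j.+1 A ^+ 2 <= L * norm_frob A ^+ 2 ->
  rate <= c0 * ((k - r)%:R / L) ->
  forall v, residual_bound k A v
    ((1 - rate * sigma_min A ^+ 2 / norm_frob A ^+ 2) * dot v v).
Proof.
move=> c00 rkn H tail hr v; apply: residual_bound_le (H v).
apply: ler_wpM2r; first exact: dot_ge0.
rewrite lerD2l lerN2 -mulrA.
apply: le_trans (_ : c0 * ((k - r)%:R / L) * (sigma_min A ^+ 2 / norm_frob A ^+ 2) <= _).
  by apply: ler_wpM2r hr; rewrite divr_ge0 // sqr_ge0.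
rewrite -mulrA; apply: ler_wpM2l => //.
by rewrite mulrACA -invfM; exact: tail_rate_le.
Qed.

End Rates.

Theorem corollary3p4 (R : realType) :
  (exists C : R, 0 < C /\
    forall (m n k : nat) (A : 'M[R]_(m, n)), \rank A = n ->
    (1 <= k <= n)%N ->
    forall (d : measure_display) (T : measurableType d) (P : probability T R)
      (S : nat -> T -> 'M[R]_(k, m)), independent_gaussian_matrices P S ->
    forall (b : 'cV[R]_m) (xstar : 'cV[R]_n), A *m xstar = b ->
    forall (x0 : 'cV[R]_n) (t : nat),
      ('E_P[(fun w => norm2 (sketch_and_project A b (S ^~ w) x0 t - xstar) ^+ 2)%R]
       <= ((1 - k%:R * sigma_min A ^+ 2 / (C * norm_frob A ^+ 2)) ^+ t
           * norm2 (x0 - xstar) ^+ 2)%:E)%E)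
  /\
  (forall beta c : R, 1 < beta -> 0 < c -> exists C : R, 0 < C /\
    forall (m n k : nat) (A : 'M[R]_(m, n)), \rank A = n ->
    polynomial_decay A beta c ->
    (1 <= k)%N -> (k.*2 <= n)%N ->
    forall (d : measure_display) (T : measurableType d) (P : probability T R)
      (S : nat -> T -> 'M[R]_(k, m)), independent_gaussian_matrices P S ->
    forall (b : 'cV[R]_m) (xstar : 'cV[R]_n), A *m xstar = b ->
    forall (x0 : 'cV[R]_n) (t : nat),
      ('E_P[(fun w => norm2 (sketch_and_project A b (S ^~ w) x0 t - xstar) ^+ 2)%R]
       <= ((1 - k%:R `^ beta * sigma_min A ^+ 2 / (C * norm_frob A ^+ 2)) ^+ t
           * norm2 (x0 - xstar) ^+ 2)%:E)%E)
  /\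
  (forall alpha c : R, 1 < alpha -> 0 < c -> exists C : R, 0 < C /\
    forall (m n k : nat) (A : 'M[R]_(m, n)), \rank A = n ->
    exponential_decay A alpha c ->
    (1 <= k)%N -> (k.*2 <= n)%N ->
    forall (d : measure_display) (T : measurableType d) (P : probability T R)
      (S : nat -> T -> 'M[R]_(k, m)), independent_gaussian_matrices P S ->
    forall (b : 'cV[R]_m) (xstar : 'cV[R]_n), A *m xstar = b ->
    forall (x0 : 'cV[R]_n) (t : nat),
      ('E_P[(fun w => norm2 (sketch_and_project A b (S ^~ w) x0 t - xstar) ^+ 2)%R]
       <= ((1 - alpha ^+ k * sigma_min A ^+ 2 / (C * norm_frob A ^+ 2)) ^+ t
           * norm2 (x0 - xstar) ^+ 2)%:E)%E).
Proof.
have [c0 [c00 contraction]] := gaussian_sketch_contraction R.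
have rate_E (x s f C : R) : x * s / (C * f) = x / C * s / f by rewrite invfM; ring.
split; [|split].
- exists c0^-1; split; first by rewrite invr_gt0.
  move=> m n k A rA /andP[k1 kn].
  apply: expected_error_le; first exact: leq_trans kn.
  have rkn : (0 < k <= n)%N by rewrite k1.
  rewrite rate_E invrK.
  apply: (contraction_rate (ltW c00) rkn (contraction _ _ _ _ _ rA rkn) (L := 1)).
    by rewrite mul1r norm_frob_sigma.
  by rewrite subn0 divr1 mulrC.
- move=> beta c b1 cpos; have bm : 0 < beta - 1 by rewrite subr_gt0.
  pose D := 1 + (beta - 1)^-1.
  have D0 : 0 < D by rewrite addr_gt0 // invr_gt0.
  (* c comes from the decay, D from [power_tail], and the power of 2 from replacing k/2 by k in the
     tail bound. *)
  pose L := c * D * 2 `^ (beta - 1).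
  have L0 : 0 < L by rewrite !mulr_gt0 // powR_gt0.
  (* The 2 pays for the rows that remain: k - k./2 >= k/2. *)
  exists (2 * L / c0); split; first by rewrite divr_gt0 // mulr_gt0.
  move=> m n k A rA decay k1 k2n.
  have kn : (k <= n)%N by apply: leq_trans k2n; rewrite -addnn leq_addr.
  have n0 : (0 < n)%N by exact: leq_trans kn.
  have kR : 0 < k%:R :> R by rewrite ltr0n.
  apply: expected_error_le => //; rewrite rate_E.
  have rkn : (k./2 < k <= n)%N.
    by rewrite kn andbT ltn_half_double -addnn -[X in (X < _)%N]addn0 ltn_add2l.
  apply: (contraction_rate (ltW c00) rkn (contraction _ _ _ _ _ rA rkn)
    (L := L * k%:R `^ (1 - beta))).
    apply: (@le_trans _ _ (\sum_(k./2 <= j < n)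
        c * sigma 1 A ^+ 2 * j.+1%:R `^ (- beta))).
      rewrite big_nat [leRHS]big_nat; apply: ler_sum => j /andP[_ jn].
      by rewrite mulrAC; exact: decay.
    rewrite -mulr_sumr; apply: le_trans (ler_wpM2l _ (power_tail _ _ b1)) _.
      by rewrite mulr_ge0 ?sqr_ge0 // ltW.
    have hk : (k./2).+1%:R `^ (1 - beta) <= 2 `^ (beta - 1) * k%:R `^ (1 - beta) :> R.
      have half : k%:R / 2 <= (k./2).+1%:R :> R.
        rewrite ler_pdivrMr // -natrM ler_nat muln2 doubleS -[leqLHS]odd_double_half.
        by rewrite -[leqRHS]addn2 addnC leq_add2l; case: odd.
      have -> : 1 - beta = - (beta - 1) by ring.
      have k2 : 0 < k%:R / 2 :> R by rewrite divr_gt0.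
      apply: (@le_trans _ _ ((k%:R / 2) `^ (- (beta - 1)))).
        rewrite !powRN lef_pV2 ?posrE ?powR_gt0 // ?ltr0n //.
        by apply: ge0_ler_powR; rewrite ?nnegrE ?ler0n ?(ltW k2) ?(ltW bm).
      rewrite powRM ?ler0n ?invr_ge0 ?ler0n // mulrC ler_wpM2r ?powR_ge0 //.
      by rewrite -powR_inv1 ?ler0n // -powRrM mulN1r opprK.
    apply: (@le_trans _ _ (c * norm_frob A ^+ 2 *
        (D * (2 `^ (beta - 1) * k%:R `^ (1 - beta))))).
      apply: ler_pM.
      - by rewrite mulr_ge0 ?sqr_ge0 // ltW.
      - by rewrite mulr_ge0 ?powR_ge0 // ltW.
      - by rewrite ler_wpM2l ?sigma1_le // ltW.
      - by rewrite ler_wpM2l // ltW.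
    by rewrite le_eqVlt /L; apply/orP; left; apply/eqP; ring.
  have kb : k%:R `^ beta * k%:R `^ (1 - beta) = k%:R :> R.
    rewrite -powRD; last by rewrite (gt_eqF kR) implybT.
    by rewrite addrC subrK powRr1 // ltW.
  have kb0 : 0 < k%:R `^ (1 - beta) :> R by rewrite powR_gt0.
  have half : k%:R / 2 <= (k - k./2)%:R :> R.
    rewrite ler_pdivrMr // -natrM ler_nat muln2 doubleB leq_subRL.
      by rewrite -[in leqRHS]addnn leq_add2r -[leqRHS]odd_double_half leq_addl.
    by rewrite leq_double ltnW //; case/andP: rkn.
  have -> : k%:R `^ beta / (2 * L / c0) = c0 * (k%:R / 2 / (L * k%:R `^ (1 - beta))).
    by rewrite -{2}kb; field; rewrite !gt_eqF.
  apply: ler_wpM2l; first exact: ltW.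
  by apply: ler_wpM2r half; rewrite invr_ge0 mulr_ge0 ?ltW.
- move=> alpha c a1 cpos; have am : 0 < alpha - 1 by rewrite subr_gt0.
  have a0 : 0 < alpha by exact: lt_trans a1.
  (* The tail starts at r = k - 1, so the geometric bound is alpha^(-k) times alpha / (alpha -
     1). *)
  pose L := c * (alpha / (alpha - 1)).
  have L0 : 0 < L by rewrite mulr_gt0 // divr_gt0.
  exists (L / c0); split; first by rewrite divr_gt0.
  move=> m n k A rA decay k1 k2n.
  have kn : (k <= n)%N by apply: leq_trans k2n; rewrite -addnn leq_addr.
  have n0 : (0 < n)%N by exact: leq_trans kn.
  apply: expected_error_le => //; rewrite rate_E.
  have rkn : (k.-1 < k <= n)%N by rewrite ltn_predL k1.
  have ak : 0 < alpha ^+ k by rewrite exprn_gt0.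
  apply: (contraction_rate (ltW c00) rkn (contraction _ _ _ _ _ rA rkn)
    (L := L / alpha ^+ k)).
    apply: (@le_trans _ _ (\sum_(k.-1 <= j < n) c * sigma 1 A ^+ 2 * alpha ^- j.+1)).
      rewrite big_nat [leRHS]big_nat; apply: ler_sum => j /andP[_ jn].
      by rewrite mulrAC; exact: decay.
    rewrite -mulr_sumr; apply: le_trans (ler_wpM2l _ (geometric_tail _ _ a1)) _.
      by rewrite mulr_ge0 ?sqr_ge0 // ltW.
    have -> : alpha ^- k.-1 = alpha / alpha ^+ k.
      by rewrite -{2}(prednK k1) exprS invfM mulrA divff ?mul1r // gt_eqF.
    apply: (@le_trans _ _ (c * norm_frob A ^+ 2 * (alpha / alpha ^+ k / (alpha - 1)))).
      apply: ler_wpM2r; first by rewrite !divr_ge0 // ltW.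
      by rewrite ler_wpM2l ?sigma1_le // ltW.
    rewrite le_eqVlt /L; apply/orP; left; apply/eqP.
    by field; rewrite !gt_eqF.
  have -> : (k - k.-1 = 1)%N by rewrite -{1}(prednK k1) subSnn.
  rewrite le_eqVlt; apply/orP; left; apply/eqP.
  by field; rewrite !gt_eqF.
Qed.
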